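(* Suppose $m$ is an odd prime and $\mathbb{F}_q$ has odd characteristic and contains a primitive $m$th root of unity $\zeta$. Then the distinct isomorphism classes of (proper) nonassociative cyclic algebras of degree $m$ over $\mathbb{F}_q$ are represented by the algebras $$(\mathbb{F}_{q^m}/\mathbb{F}_q,\sigma,a),$$ where $\mathbb{F}_{q^m}$ is the unique cyclic Galois field extension of $\mathbb{F}_q$ of degree $m$, (1) $\sigma$ is a generator of $\mathrm{Gal}(\mathbb{F}_{q^m}/\mathbb{F}_q)$, and (2) $a\in\mathcal{S}(\mathbb{F}_{q^m})$. That is, every proper nonassociative cyclic algebra of degree $m$ over $\mathbb{F}_q$ is isomorphic to exactly one such algebra, for exactly one pair $(\sigma,a)$.
   Context: For $\sigma$ a generator of $\mathrm{Gal}(\mathbb{F}_{q^m}/\mathbb{F}_q)$ and $a\in\mathbb{F}_{q^m}$, the nonassociative cyclic algebra $(\mathbb{F}_{q^m}/\mathbb{F}_q,\sigma,a)$ of degree $m$ is the Petit algebra $R/R(t^m-a)$, $R=\mathbb{F}_{q^m}[t;\sigma]$ the twisted polynomial ring with $tc=\sigma(c)t$: the $\mathbb{F}_q$-vector space of polynomials of degree $<m$ with product $g\circ h$ equal to the remainder $r$ in the right division $gh=q'(t^m-a)+r$, $\deg r<m$. It is proper (not associative) when $a\in\mathbb{F}_{q^m}\setminus\mathbb{F}_q$. Isomorphism means $\mathbb{F}_q$-algebra isomorphism. Definition of $\mathcal{S}(\mathbb{F}_{q^m})$. Fix a generator $\sigma$ of $\mathrm{Gal}(\mathbb{F}_{q^m}/\mathbb{F}_q)$.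 The field $\mathbb{F}_{q^m}$ is the splitting field of some $x^m-b$ with $b\in\mathbb{F}_q^\times\setminus(\mathbb{F}_q^\times)^m$; fix a root $\beta\in\mathbb{F}_{q^m}$ of $x^m-b$ with $\sigma(\beta)=\zeta\beta$, so $\{1,\beta,\dots,\beta^{m-1}\}$ is an $\mathbb{F}_q$-basis of $\mathbb{F}_{q^m}$. Let $\mathcal{I}$ be the set of nonempty subsets of $\{0,1,\dots,m-1\}$ other than $\{0\}$. For $I\in\mathcal{I}$ with elements $i_0<i_1<\cdots<i_k$, $k\geq 1$, let $$\Delta_I=\{(\zeta^{s(i_1-i_0)},\zeta^{s(i_2-i_0)},\dots,\zeta^{s(i_k-i_0)})\mid 1\leq s\leq m\},$$ a subgroup of the $k$-fold direct product $\mathbb{F}_q^{[\times k]}=\mathbb{F}_q^\times\times\cdots\times\mathbb{F}_q^\times$, and write $\mathbb{F}_q^{[\times k]}/\Delta_I$ for a fixed choice of representatives of the cosets. For $a_{i_0}\in\mathbb{F}_q^\times$ put $$K(I;a_{i_0})=\Big\{a_{i_0}\beta^{i_0}+\sum_{j=1}^k a_{i_j}\beta^{i_j}\ \Big|\ (a_{i_1},\dots,a_{i_k})\in\mathbb{F}_q^{[\times k]}/\Delta_I\Big\},$$ and for $I=\{i_0\}\in\mathcal{I}$ put $K(I;a_{i_0})=\{a_{i_0}\beta^{i_0}\}$. Finally $\mathcal{S}(\mathbb{F}_{q^m})=\bigcup_{I\in\mathcal{I}}K(I;1)\subset\mathbb{F}_{q^m}\setminus\mathbb{F}_q$. *)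

(* Defs.v *)
From mathcomp Require Import all_boot all_order all_fingroup all_algebra.
From mathcomp Require Import all_solvable all_field.

Set Implicit Arguments.
Unset Strict Implicit.
Unset Printing Implicit Defensive.

Import GRing.Theory.
Local Open Scope ring_scope.

Section SkewPolynomials.

Variables (K : fieldType) (s : K -> K).
Implicit Types f g h q r : {poly K}.

(* K[t; s] has the same underlying additive group as {poly K}, the list of
   coefficients being those written on the left of the powers of t.  The rule
   t c = s(c) t gives (x t^i) (y t^j) = x s^i(y) t^(i+j). *)
Definition skew_mul g h : {poly K} :=
  \sum_(i < size g) \sum_(j < size h) (g`_i * iter i s h`_j) *: 'X^(i + j).

(* Right division by a monic f: while deg g >= deg f, subtract from g the left
   multiple (lc g) t^(deg g - deg f) f.  The first argument is only fuel. *)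
Fixpoint skew_rmod_rec (n : nat) f g : {poly K} :=
  if n is n'.+1 then
    if (size g < size f)%N then g
    else skew_rmod_rec n' f
           (g - skew_mul (lead_coef g *: 'X^(size g - size f)) f)
  else g.

Definition skew_rmod f g : {poly K} := skew_rmod_rec (size g) f g.

End SkewPolynomials.

Section SkewDivision.

Variables (K : fieldType) (s : {rmorphism K -> K}).
Implicit Types f g h q r : {poly K}.

Let iter0 i : iter i s 0 = 0.
Proof. by elim: i => //= i ->; rewrite rmorph0. Qed.

Let iter1 i : iter i s 1 = 1.
Proof. by elim: i => //= i ->; rewrite rmorph1. Qed.

Lemma skew_mul_widen n g h : (size g <= n)%N ->
  skew_mul s g h =
  \sum_(i < n) \sum_(j < size h) (g`_i * iter i s h`_j) *: 'X^(i + j).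
Proof.
move=> le_gn; rewrite /skew_mul.
rewrite (big_ord_widen n (fun i => \sum_(j < size h)
  (g`_i * iter i s h`_j) *: 'X^(i + j))) // big_mkcond /=.
apply: eq_bigr => i _; case: ltnP => // le_gi.
by rewrite big1 // => j _; rewrite nth_default // mul0r scale0r.
Qed.

Lemma skew_mulDl g1 g2 h :
  skew_mul s (g1 + g2) h = skew_mul s g1 h + skew_mul s g2 h.
Proof.
pose n := maxn (size (g1 + g2)) (maxn (size g1) (size g2)).
rewrite !(@skew_mul_widen n) ?leq_max ?leqnn ?orbT // -big_split /=.
apply: eq_bigr => i _; rewrite -big_split /=.
by apply: eq_bigr => j _; rewrite coefD mulrDl scalerDl.
Qed.

Lemma skew_mulNl g h : skew_mul s (- g) h = - skew_mul s g h.
Proof.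
rewrite /skew_mul size_polyN -sumrN; apply: eq_bigr => i _.
by rewrite -sumrN; apply: eq_bigr => j _; rewrite coefN mulNr scaleNr.
Qed.

Lemma size_skew_mul_leq g h :
  (size (skew_mul s g h) <= (size g + size h).-1)%N.
Proof.
apply: (leq_trans (size_sum _ _ _)); apply/bigmax_leqP => i _.
apply: (leq_trans (size_sum _ _ _)); apply/bigmax_leqP => j _.
apply: (leq_trans (size_scale_leq _ _)); rewrite size_polyXn.
by rewrite -subn1 ltn_subRL addnC addn1 -addSn -addnS leq_add ?ltn_ord.
Qed.

Lemma lead_skew_mul g h : g != 0 -> h \is monic ->
  (skew_mul s g h)`_(size g + size h).-2 = lead_coef g.
Proof.
move=> nz_g mon_h; have nz_h := monic_neq0 mon_h.
have [n def_n] : {n | size g = n.+1}.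
  by exists (size g).-1; rewrite prednK // lt0n size_poly_eq0.
have [p def_p] : {p | size h = p.+1}.
  by exists (size h).-1; rewrite prednK // lt0n size_poly_eq0.
have hp : h`_p = 1 by move/monicP: mon_h; rewrite /lead_coef def_p.
rewrite /skew_mul def_n def_p addnS addSn /= big_ord_recr /= big_ord_recr /=.
rewrite coefD coef_sum big1 ?add0r; last first.
  move=> i _; rewrite coef_sum big1 // => j _.
  rewrite coefZ coefXn gtn_eqF ?mulr0 //.
  by rewrite -addSn leq_add ?ltn_ord // -ltnS ltn_ord.
rewrite coefD coef_sum big1 ?add0r; last first.
  move=> j _; rewrite coefZ coefXn gtn_eqF ?mulr0 //.
  by rewrite ltn_add2l ltn_ord.
by rewrite coefZ coefXn eqxx hp iter1 !mulr1 /lead_coef def_n.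
Qed.

Lemma skew_rmodP f g : f \is monic ->
  (exists q, g = skew_mul s q f + skew_rmod s f g) /\
  (size (skew_rmod s f g) < size f)%N.
Proof.
move=> mon_f; rewrite /skew_rmod.
have f_gt0 : (0 < size f)%N by rewrite lt0n size_poly_eq0 monic_neq0.
suff: forall n, (size g <= n)%N ->
    (exists q, g = skew_mul s q f + skew_rmod_rec s n f g) /\
    (size (skew_rmod_rec s n f g) < size f)%N by apply.
move=> n; elim: n g => [|n IHn] g le_gn /=.
  split; last exact: leq_ltn_trans le_gn f_gt0.
  by exists 0; rewrite /skew_mul size_poly0 big_ord0 add0r.
case: ltnP => [lt_gf | le_fg].
  by split=> //; exists 0; rewrite /skew_mul size_poly0 big_ord0 add0r.
have g_gt0 := leq_trans f_gt0 le_fg.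
have nz_lg : lead_coef g != 0 by rewrite lead_coef_eq0 -size_poly_eq0 -lt0n.
set M := _ *: 'X^_.
have sM : size M = (size g - size f).+1 by rewrite size_scale // size_polyXn.
have nzM : M != 0 by rewrite -size_poly_eq0 sM.
have lM : lead_coef M = lead_coef g by rewrite lead_coefZ lead_coefXn mulr1.
have sMf : (size M + size f).-1 = size g by rewrite sM addSn subnK.
have le_n : (size (g - skew_mul s M f)%R <= n)%N.
  rewrite -ltnS; apply: leq_trans le_gn.
  have le_g : (size (g - skew_mul s M f)%R <= size g)%N.
    apply: leq_trans (size_polyD _ _) _; rewrite size_polyN geq_max leqnn /=.
    by apply: leq_trans (size_skew_mul_leq _ _) _; rewrite sMf.
  rewrite ltn_neqAle le_g andbT; apply/eqP => eq_sz.
  have : lead_coef (g - skew_mul s M f) = 0.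
    rewrite {1}/lead_coef eq_sz coefB -{2}sMf lead_skew_mul // lM.
    by rewrite /lead_coef subrr.
  by move/eqP; rewrite lead_coef_eq0 -size_poly_eq0 eq_sz -leqn0 leqNgt g_gt0.
have [[q def_q] lt_r] := IHn _ le_n; split=> //.
by exists (q + M); rewrite skew_mulDl addrAC -def_q subrK.
Qed.

Lemma skew_rmod_uniq f q r : f \is monic -> (size r < size f)%N ->
  skew_rmod s f (skew_mul s q f + r) = r.
Proof.
move=> mon_f lt_r.
have [[q' def_q'] lt_r'] := skew_rmodP (skew_mul s q f + r) mon_f.
set r' := skew_rmod _ _ _ in def_q' lt_r' *.
have eq_d : skew_mul s (q - q') f = r' - r.
  apply/eqP; rewrite skew_mulDl skew_mulNl subr_eq addrAC eq_sym subr_eq.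
  by rewrite eq_sym def_q' addrC.
have [/eqP|nz_d] := eqVneq (q - q') 0.
  rewrite subr_eq0 => /eqP eq_q; apply/eqP; rewrite -subr_eq0 -eq_d.
  by rewrite eq_q subrr /skew_mul size_poly0 big_ord0.
have := lead_skew_mul nz_d mon_f; rewrite eq_d nth_default => [/esym/eqP|].
  by rewrite lead_coef_eq0 (negPf nz_d).
apply: leq_trans (size_polyD _ _) _; rewrite size_polyN.
have : (0 < size (q - q')%R)%N by rewrite lt0n size_poly_eq0.
case: (size (q - q')) (size f) lt_r lt_r' => [|n] [|p] // ? ? _.
by rewrite addnS /= geq_max !(leq_trans _ (leq_addl n p)).
Qed.

End SkewDivision.

Section PetitAlgebra.

Variables (F : fieldType) (m : nat).

(* The product of the nonassociative cyclic algebra (K/F, s, a) of degree m, on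
   the space {poly_m K} of polynomials of degree < m.  npolyp m only truncates
   at degree m, hence is the identity on the remainder when 0 < m. *)
Definition petit_mul (K : fieldExtType F) (s : K -> K) (a : K)
    (g h : {poly_m K}) : {poly_m K} :=
  npolyp m (skew_rmod s ('X^m - a%:P) (skew_mul s g h)).

Lemma petit_mulP (K : fieldExtType F) (s : {rmorphism K -> K}) (a : K)
    (g h : {poly_m K}) : (0 < m)%N ->
  exists q : {poly K},
    skew_mul s g h =
    skew_mul s q ('X^m - a%:P) + (petit_mul s a g h : {poly K}).
Proof.
move=> m_gt0; have mon : 'X^m - a%:P \is monic by exact: monicXnsubC.
have [[q def_q] lt_r] := skew_rmodP s (skew_mul s g h) mon.
exists q; rewrite {1}def_q; congr (_ + _); rewrite /petit_mul npolypK //.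
by rewrite size_XnsubC // in lt_r.
Qed.

(* K is a cyclic Galois extension of F of degree m, and s generates its Galois
   group. *)
Definition cyclic_generator (K : splittingFieldType F) (s : gal_of {:K}) :=
  [/\ \dim {:K} = m, galois 1%AS {:K} & generator 'Gal({:K} / 1%AS) s].

Definition proper_petit (K : fieldExtType F) (s : K -> K) (a : K) : Prop :=
  ~ associative (petit_mul s a).

Definition petit_isomorphic (K : fieldExtType F) (s : K -> K) (a : K)
    (L : fieldExtType F) (s' : L -> L) (a' : L) : Prop :=
  exists G : {poly_m K} -> {poly_m L},
    [/\ bijective G,
        (* F-linearity: F acts on {poly_m K} through F -> K *)
        forall (c : F) g h, G (c%:A *: g + h) = c%:A *: G g + G h
      & forall g h, G (petit_mul s a g h) = petit_mul s' a' (G g) (G h)].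

End PetitAlgebra.

Section Representatives.

Variables (F : finFieldType) (m : nat).

(* i_0 < i_1 < ... < i_k are the elements of I. *)
Definition elt (I : {set 'I_m}) (j : nat) : nat := nth 0%N (map val (enum I)) j.

Lemma elt_lt (I : {set 'I_m}) i j :
  (i < j)%N -> (j < #|I|)%N -> (elt I i < elt I j)%N.
Proof.
move=> lt_ij lt_j.
have srt : sorted ltn (map val (enum I)).
  apply: (subseq_sorted ltn_trans _ (iota_ltn_sorted 0 m)).
  by rewrite -val_enum_ord map_subseq // enumT filter_subseq.
by apply: (sorted_ltn_nth ltn_trans); rewrite ?inE ?size_map -?cardE // (ltn_trans lt_ij).
Qed.

Definition kof (I : {set 'I_m}) : nat := #|I|.-1.

(* The k-fold direct product of the multiplicative group of F. *)
Notation units k := {dffun forall _ : 'I_k, {unit F}}.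

(* s : 'I_m stands for the exponent s + 1 between 1 and m; the components of the
   tuple u are indexed from 0, so u_j corresponds to i_(j+1). *)
Definition Delta (zeta : F) (I : {set 'I_m}) : {set units (kof I)} :=
  [set u : units (kof I) | [exists s : 'I_m, [forall j,
     FinRing.uval (u j) == zeta ^+ (s.+1 * (elt I j.+1 - elt I 0))]]].

(* X I is a choice of representatives of the cosets of Delta_I, for every I
   with at least two elements. *)
Definition coset_representatives (zeta : F)
    (X : forall I : {set 'I_m}, {set units (kof I)}) : Prop :=
  forall I : {set 'I_m}, (1 < #|I|)%N ->
    is_transversal (X I) (rcosets (Delta zeta I) [set: units (kof I)])
      [set: units (kof I)].

Variables (L : fieldExtType F) (beta : L).
Variable X : forall I : {set 'I_m}, {set units (kof I)}.

Definition KI (I : {set 'I_m}) (c : F) (x : L) : Prop :=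
  if #|I| == 1%N then x = c *: beta ^+ elt I 0
  else exists2 u : units (kof I), u \in X I &
    x = c *: beta ^+ elt I 0
        + \sum_(j < kof I) FinRing.uval (u j) *: beta ^+ elt I j.+1.

Definition SL (x : L) : Prop :=
  exists I : {set 'I_m},
    [/\ I != set0, I != [set i : 'I_m | val i == 0%N] & KI I 1 x].

End Representatives.

(* Main.v *)
From HB Require Import structures.
Require Import Defs.
From mathcomp Require Import all_boot all_order all_fingroup all_algebra.
From mathcomp Require Import all_solvable all_field.

Set Implicit Arguments.
Unset Strict Implicit.
Unset Printing Implicit Defensive.

Import GRing.Theory.
Local Open Scope ring_scope.

(** Write [A(s, a)] for the algebra [K[t; s] / K[t; s](t^m - a)]. In it [t^j *
    h] is obtained from [h] by applying [j] times the semilinear map [h |-> t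
    h], with [t^m] replaced by [a]; only the associators in which a product of
    powers of [t] reaches the degree [m] can be nonzero, and they measure the
    difference between [a] and its conjugates. So [A(s, a)] is associative when
    [s a = a] ([petit_associative_fixed]); otherwise its left nucleus is exactly
    the field [K] ([left_nucleus_const]).

    An isomorphism [G : A(s, d) -> A(s', a)] of such algebras therefore
    restricts to a field isomorphism [rho] ([iso_restricts_to_constants]). By
    the commutation rule [t c = s(c) t], it sends each [t^j] to some [k_j t^i],
    where [s'^i] is the conjugate of [s^j] by [rho]. The associators [(t, t^j,
    z)] vanish for [j < m - 1], whereas [(t^i, t^(m-1), t)] does not for [0 <
    i]; so [G] preserves the degree [m - 1], which forces [i = j]
    ([iso_top_degree]): hence [s'] is the conjugate of [s], [G t = k t], and
    [rho d] is the norm of [k] times [a] ([iso_tnorm]). Conversely any such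
    [rho] and [k] define an isomorphism ([petit_isomorphic_twist]).

    Over a finite field containing the [m]-th roots of unity, each cyclic
    extension of degree [m] is generated by an [m]-th root of [b]
    ([radical_generator]), so that it can be identified with [L]
    ([radical_transfer]); the generators of the Galois groups are then
    determined by their eigenvalue at this root, and the norm is onto
    ([tnorm_surjective]). It remains to classify the elements [a = \sum_i a_i
    beta^i] outside [F] up to nonzero scalars and up to the Galois group, which
    acts by [a_i |-> zeta^(r i) a_i]. The support of [a] is invariant;
    normalizing the first nonzero coefficient to 1, what remains is the action
    of [Delta_I] on the other ones, whose orbits are represented exactly once in
    the chosen system ([rep_weight_exists] and [rep_weight_unique]). *)

(** * Monomials in the nonassociative cyclic algebra *)

Section SkewProduct.

Variables (K : fieldType) (s : {rmorphism K -> K}).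
Implicit Types (g h : {poly K}) (c d : K).

Lemma iter_rmorph0 i : iter i s 0 = 0.
Proof. by elim: i => //= i ->; rewrite rmorph0. Qed.

Lemma iter_rmorph1 i : iter i s 1 = 1.
Proof. by elim: i => //= i ->; rewrite rmorph1. Qed.

Lemma iter_rmorphD i c d : iter i s (c + d) = iter i s c + iter i s d.
Proof. by elim: i => //= i ->; rewrite rmorphD. Qed.

Lemma iter_rmorphM i c d : iter i s (c * d) = iter i s c * iter i s d.
Proof. by elim: i => //= i ->; rewrite rmorphM. Qed.

Lemma iter_rmorph_eq0 i c : (iter i s c == 0) = (c == 0).
Proof. by elim: i => //= i <-; rewrite fmorph_eq0. Qed.

Lemma skew_mulE n p g h : (size g <= n)%N -> (size h <= p)%N ->
  skew_mul s g h =
  \sum_(i < n) \sum_(j < p) (g`_i * iter i s h`_j) *: 'X^(i + j).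
Proof.
move=> le_gn le_hp; rewrite (skew_mul_widen s h le_gn).
apply: eq_bigr => i _.
rewrite (big_ord_widen p (fun j => (g`_i * iter i s h`_j) *: 'X^(i + j))) //.
rewrite big_mkcond /=; apply: eq_bigr => j _; case: ltnP => // le_hj.
by rewrite (nth_default _ le_hj) iter_rmorph0 mulr0 scale0r.
Qed.

Lemma skew_mulDr g h1 h2 :
  skew_mul s g (h1 + h2) = skew_mul s g h1 + skew_mul s g h2.
Proof.
pose n := maxn (size (h1 + h2)) (maxn (size h1) (size h2)).
rewrite !(@skew_mulE (size g) n) ?leq_max ?leqnn ?orbT // -big_split /=.
apply: eq_bigr => i _; rewrite -big_split /=; apply: eq_bigr => j _.
by rewrite coefD iter_rmorphD mulrDr scalerDl.
Qed.

Lemma skew_mul0l h : skew_mul s 0 h = 0.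
Proof. by rewrite /skew_mul size_poly0 big_ord0. Qed.

Lemma skew_mul_monomial c d k l :
  skew_mul s (c *: 'X^k) (d *: 'X^l) = (c * iter k s d) *: 'X^(k + l).
Proof.
have sz e n : (size (e *: 'X^n : {poly K}) <= n.+1)%N.
  by rewrite (leq_trans (size_scale_leq _ _)) // size_polyXn.
have cf e n (i : 'I_n.+1) : (e *: 'X^n)`_i = if i == ord_max then e else 0.
  by rewrite coefZ coefXn -val_eqE /=; case: eqP; rewrite ?mulr1 ?mulr0.
rewrite (@skew_mulE k.+1 l.+1) // (bigD1 ord_max) //=.
rewrite [X in _ + X]big1 ?addr0 => [|i ne_i].
  rewrite (bigD1 ord_max) //= big1 ?addr0 => [|j ne_j].
    by rewrite !coefZ !coefXn !eqxx !mulr1.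
  by rewrite [in iter _ _ _]cf (negPf ne_j) iter_rmorph0 mulr0 scale0r.
by rewrite big1 // => j _; rewrite cf (negPf ne_i) mul0r scale0r.
Qed.

End SkewProduct.

Section PetitMonomials.

Variables (F : fieldType) (m : nat) (K : fieldExtType F).
Variables (s : {rmorphism K -> K}) (a : K).
Hypothesis m_gt0 : (0 < m)%N.
Implicit Types (g h : {poly_m K}) (c d : K).

Local Notation "g ** h" := (petit_mul s a g h) (at level 40).

(** The remainder of [t^e] modulo [t^m - a], for [e < 2m]: as
    [t^e = t^(e-m) (t^m - a) + s^(e-m)(a) t^(e-m)], the constant [a] is twisted
    on its way to the left. *)
Definition tred e : {poly K} :=
  if (e < m)%N then 'X^e else iter (e - m) s a *: 'X^(e - m).

Lemma petit_mulE g h :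
  petit_mul s a g h = \sum_(i < m) \sum_(j < m)
    (g`_i * iter i s h`_j) *: tred (i + j) :> {poly K}.
Proof.
set r := RHS.
have sz_r : (size r <= m)%N.
  rewrite (leq_trans (size_sum _ _ _)) //; apply/bigmax_leqP => i _.
  rewrite (leq_trans (size_sum _ _ _)) //; apply/bigmax_leqP => j _.
  rewrite (leq_trans (size_scale_leq _ _)) // /tred.
  case: ltnP => [lt_m | le_m]; first by rewrite size_polyXn.
  rewrite (leq_trans (size_scale_leq _ _)) // size_polyXn.
  by rewrite -(ltn_add2r m) subnK // -addnS leq_add // ltnW.
have szf : size ('X^m - a%:P) = m.+1 by rewrite size_XnsubC.
suff [q def_q] : exists q, skew_mul s g h = skew_mul s q ('X^m - a%:P) + r.
  rewrite /petit_mul def_q skew_rmod_uniq ?monicXnsubC ?szf //.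
  by rewrite npolypK.
(* The quotient collects the monomials of degree at least m. *)
exists (\sum_(i < m) \sum_(j < m) (if (i + j < m)%N then 0 else
  (g`_i * iter i s h`_j) *: 'X^(i + j - m))).
have sum_l (I : finType) (G : I -> {poly K}) f :
    skew_mul s (\sum_i G i) f = \sum_i skew_mul s (G i) f.
  apply: (big_morph (fun q => skew_mul s q f)) => [x y|].
    exact: skew_mulDl.
  exact: skew_mul0l.
rewrite sum_l /r -big_split /= (skew_mulE s (size_npoly g) (size_npoly h)).
apply: eq_bigr => i _; rewrite sum_l -big_split /=; apply: eq_bigr => j _.
rewrite /tred; case: ltnP => [lt_m | le_m]; first by rewrite skew_mul0l add0r.
have -> : 'X^m - a%:P = 1 *: 'X^m + (- a) *: 'X^0 :> {poly K}.
  by rewrite scale1r expr0 scaleNr alg_polyC.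
rewrite skew_mulDr !skew_mul_monomial subnK // addn0 scalerA -addrA -scalerDl.
have -> : iter (i + j - m) s (- a) = - iter (i + j - m) s a.
  by elim: (i + j - m)%N => //= n ->; rewrite rmorphN.
by rewrite iter_rmorph1 mulr1 mulrN addNr scale0r addr0.
Qed.

(** The truncation only serves to land in [{poly_m K}]: monomials are formed for
    [i < m]. *)
Definition mono c i : {poly_m K} := npolyp m (c *: 'X^i).

Lemma coef_mono c i k : (i < m)%N -> (mono c i)`_k = if k == i then c else 0.
Proof.
move=> lt_im; rewrite coef_npolyp coefZ coefXn.
by case: (ltnP k m) => [_ | le_mk]; case: eqP => [e|_];
  rewrite ?mulr1 ?mulr0 //;
  rewrite -e ltnNge le_mk in lt_im.
Qed.

Lemma monoD c d i : mono (c + d) i = mono c i + mono d i.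
Proof.
apply/npolyP => k; rewrite coefD !coef_npolyp !coefZ mulrDl.
by case: ifP; rewrite ?addr0.
Qed.

Lemma mono0 i : mono 0 i = 0.
Proof. by apply/npolyP => k; rewrite coef_npolyp scale0r coef0; case: ifP. Qed.

Lemma mono_sum g : g = \sum_(i < m) mono g`_i i.
Proof.
apply/npolyP => k; rewrite coefn_sum; case: (ltnP k m) => [lt_k | le_k].
  rewrite (bigD1 (Ordinal lt_k)) //= coef_mono // eqxx big1 ?addr0 // => i.
  by rewrite coef_mono // -val_eqE /= eq_sym => /negPf->.
rewrite big_coef_npoly // big1 // => i _.
by rewrite coef_mono // gtn_eqF // (leq_trans (ltn_ord i)).
Qed.

Lemma petit_mulDl g1 g2 h : (g1 + g2) ** h = g1 ** h + g2 ** h.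
Proof.
apply/val_inj; rewrite /= !petit_mulE -big_split /=; apply: eq_bigr => i _.
rewrite -big_split /=; apply: eq_bigr => j _.
by rewrite coefD mulrDl scalerDl.
Qed.

Lemma petit_mulDr g h1 h2 : g ** (h1 + h2) = g ** h1 + g ** h2.
Proof.
apply/val_inj; rewrite /= !petit_mulE -big_split /=; apply: eq_bigr => i _.
rewrite -big_split /=; apply: eq_bigr => j _.
by rewrite coefD iter_rmorphD mulrDr scalerDl.
Qed.

Lemma petit_mul0l h : 0 ** h = 0.
Proof. by apply: (addrI (0 ** h)); rewrite -petit_mulDl !addr0. Qed.

Lemma petit_mul0r g : g ** 0 = 0.
Proof. by apply: (addrI (g ** 0)); rewrite -petit_mulDr !addr0. Qed.

Lemma petit_suml (I : finType) (G : I -> {poly_m K}) h :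
  (\sum_i G i) ** h = \sum_i G i ** h.
Proof.
by apply: (big_morph (fun g => g ** h)) => [x y|];
  rewrite ?petit_mulDl ?petit_mul0l.
Qed.

Lemma petit_sumr (I : finType) (G : I -> {poly_m K}) g :
  g ** (\sum_i G i) = \sum_i g ** G i.
Proof.
by apply: (big_morph (fun h => g ** h)) => [x y|];
  rewrite ?petit_mulDr ?petit_mul0r.
Qed.

Lemma petit_mul_mono c d i j : (i < m)%N -> (j < m)%N ->
  mono c i ** mono d j = npolyp m ((c * iter i s d) *: tred (i + j)).
Proof.
move=> lt_i lt_j; apply/val_inj; rewrite /= petit_mulE.
rewrite (bigD1 (Ordinal lt_i)) //= [X in _ + X]big1 ?addr0 => [|k ne_k].
  rewrite (bigD1 (Ordinal lt_j)) //= [X in _ + X]big1 ?addr0 => [|k ne_k].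
    rewrite !coef_mono // !eqxx npolypK // (leq_trans (size_scale_leq _ _)) //.
    rewrite /tred; case: ltnP => [lt_m | le_m]; first by rewrite size_polyXn.
    rewrite (leq_trans (size_scale_leq _ _)) // size_polyXn.
    by rewrite -(ltn_add2r m) subnK // -addnS leq_add // ltnW.
  rewrite [X in iter i s X]coef_mono // -val_eqE /= in ne_k *.
  by rewrite (negPf ne_k) iter_rmorph0 mulr0 scale0r.
rewrite big1 // => l _; rewrite coef_mono // -val_eqE /= in ne_k *.
by rewrite (negPf ne_k) mul0r scale0r.
Qed.

Lemma mono_mul c d i j : (i + j < m)%N ->
  mono c i ** mono d j = mono (c * iter i s d) (i + j).
Proof.
move=> lt_m; have lt_i := leq_ltn_trans (leq_addr j i) lt_m.
have lt_j := leq_ltn_trans (leq_addl i j) lt_m.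
by rewrite petit_mul_mono // /tred lt_m.
Qed.

Lemma mono_mul_wrap c d i j : (i < m)%N -> (j < m)%N -> (m <= i + j)%N ->
  mono c i ** mono d j =
  mono (c * iter i s d * iter (i + j - m) s a) (i + j - m).
Proof.
by move=> lt_i lt_j le_m;
  rewrite petit_mul_mono // /tred ltnNge le_m /= scalerA.
Qed.

Lemma petit_associative :
  (forall c d e i j k, (i < m)%N -> (j < m)%N -> (k < m)%N ->
     mono c i ** (mono d j ** mono e k) = (mono c i ** mono d j) ** mono e k) ->
  associative (@petit_mul F m K s a).
Proof.
move=> assoc_mono x y z; rewrite (mono_sum x) !petit_suml.
apply: eq_bigr => i _; rewrite (mono_sum y) petit_suml !petit_sumr petit_suml.
apply: eq_bigr => j _; rewrite (mono_sum z) !petit_sumr.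
by apply: eq_bigr => k _; apply: assoc_mono.
Qed.

(** When [s^m = 1] and [s] fixes [a], the element [t^m = a] commutes with [K]
    and [t], so that [c t^e] makes sense for all [e] and multiplies as in the
    twisted polynomial ring, which is associative. *)
Lemma petit_associative_fixed : (forall x, iter m s x = x) -> s a = a ->
  associative (@petit_mul F m K s a).
Proof.
move=> s_m s_a; have s_ia i : iter i s a = a by elim: i => //= i ->.
have s_iaX i n : iter i s (a ^+ n) = a ^+ n.
  by elim: n => [|n IHn]; rewrite ?iter_rmorph1 // !exprS iter_rmorphM IHn s_ia.
have s_mod x e : iter (e %% m) s x = iter e s x.
  rewrite [in RHS](divn_eq e m) addnC iterD; congr iter.
  by elim: (e %/ m)%N => // n IHn; rewrite mulSn iterD -IHn s_m.
pose M c e := mono (c * a ^+ (e %/ m)) (e %% m).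
have ME c e : (e < m)%N -> mono c e = M c e.
  by move=> lt_e; rewrite /M divn_small // modn_small // mulr1.
have MM c d e f : M c e ** M d f = M (c * iter e s d) (e + f)%N.
  have [lt_e lt_f] := (ltn_pmod e m_gt0, ltn_pmod f m_gt0).
  have def_ef: (e + f = (e %/ m + f %/ m) * m + (e %% m + f %% m))%N.
    by rewrite mulnDl addnACA -!divn_eq.
  rewrite /M def_ef divnMDl // modnMDl.
  have [lt_m | le_m] := ltnP (e %% m + f %% m) m.
    rewrite mono_mul // (divn_small lt_m) (modn_small lt_m) addn0 iter_rmorphM.
    by rewrite s_mod s_iaX exprD mulrACA mulrA.
  rewrite mono_mul_wrap // iter_rmorphM s_mod s_iaX s_ia.
  have lt_r : (e %% m + f %% m - m < m)%N.
    by rewrite ltn_subLR // -addnS leq_add // ltnW.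
  have -> : ((e %% m + f %% m) %/ m = 1)%N.
    by rewrite -(subnK le_m) divnDr ?dvdnn // divnn m_gt0 divn_small.
  have -> : ((e %% m + f %% m) %% m = e %% m + f %% m - m)%N.
    by rewrite -[in LHS](subnK le_m) modnDr modn_small.
  congr (mono _ _); rewrite !exprD expr1 !mulrA; congr (_ * _ * _).
  by rewrite mulrAC.
apply: petit_associative => c d e i j k lt_i lt_j lt_k.
by rewrite !ME // !MM iter_rmorphM iterD addnA mulrA.
Qed.

End PetitMonomials.

(** * Isomorphisms from norms, and the left nucleus *)

Section TwistedNorm.

Variables (K : fieldType) (s : {rmorphism K -> K}).

(** The coefficient of [t^j] in [(k t)^j]; for [j = m] this is the norm of the
    cyclic extension. *)
Definition tnorm (k : K) j : K := \prod_(l < j) iter l s k.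

Lemma tnorm0 k : tnorm k 0 = 1. Proof. exact: big_ord0. Qed.

Lemma tnormS k j : tnorm k j.+1 = k * s (tnorm k j).
Proof. by rewrite /tnorm big_ord_recl /= rmorph_prod. Qed.

Lemma tnormD k i j : tnorm k (i + j) = tnorm k i * iter i s (tnorm k j).
Proof.
elim: i => [|i IHi]; first by rewrite tnorm0 mul1r.
by rewrite addSn !tnormS IHi rmorphM mulrA.
Qed.

Lemma tnormM j : {morph tnorm^~ j : k k' / k * k'}.
Proof.
move=> k k'; rewrite /tnorm -big_split; apply: eq_bigr => i _.
exact: iter_rmorphM.
Qed.

Lemma tnormX k n j : tnorm (k ^+ n) j = tnorm k j ^+ n.
Proof.
elim: n => [|n IHn]; last by rewrite !exprS tnormM IHn.
by rewrite !expr0 /tnorm big1 // => i _; rewrite iter_rmorph1.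
Qed.

Lemma tnorm_eq0 k j : (tnorm k j == 0) = (k == 0) && (0 < j)%N.
Proof.
elim: j => [|j IHj]; first by rewrite tnorm0 oner_eq0 andbF.
by rewrite tnormS mulf_eq0 fmorph_eq0 IHj andbT; case: eqP.
Qed.

End TwistedNorm.

Section PetitIsomorphism.

Variables (F : fieldType) (m : nat) (K L : fieldExtType F).
Variables (s : {rmorphism K -> K}) (d : K) (s' : {rmorphism L -> L}) (a : L).
Hypothesis m_gt0 : (0 < m)%N.

(** The isomorphism is the one with [x |-> phi x] on [K] and [t |-> k t]; the
    hypothesis on [phi d] says that it is compatible with [t^m = d]. *)
Lemma petit_isomorphic_twist (phi : {rmorphism K -> L}) (k : L) :
    bijective phi -> (forall x, phi (s x) = s' (phi x)) ->
    (forall c : F, phi c%:A = c%:A) -> k != 0 -> phi d = tnorm s' k m * a ->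
  petit_isomorphic m s d s' a.
Proof.
move=> [psi phiK psiK] phi_s phi_alg nz_k phi_d.
have nz_n i : tnorm s' k i != 0 by rewrite tnorm_eq0 (negPf nz_k).
have phi_iter i x : phi (iter i s x) = iter i s' (phi x).
  by elim: i => //= i <-.
pose G (g : {poly_m K}) : {poly_m L} :=
  npolyp m (\poly_(i < m) (phi g`_i * tnorm s' k i)).
have coefG g i : (G g)`_i = phi g`_i * tnorm s' k i.
  rewrite coef_npolyp coef_poly; case: ltnP => // le_mi.
  by rewrite big_coef_npoly // rmorph0 mul0r.
have GD g h : G (g + h) = G g + G h.
  by apply/npolyP => i; rewrite !(coefD, coefG) rmorphD mulrDl.
have G0 : G 0 = 0 by apply: (addrI (G 0)); rewrite -GD !addr0.
have G_sum (I : finType) (f : I -> {poly_m K}) :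
  G (\sum_i f i) = \sum_i G (f i) by apply: big_morph.
have G_mono c i : (i < m)%N -> G (mono m c i) = mono m (phi c * tnorm s' k i) i.
  move=> lt_i; apply/npolyP => j; rewrite coefG !coef_mono //.
  by case: eqP => [->|]; rewrite ?rmorph0 ?mul0r.
exists G; split=> [|c g h|g h].
- exists (fun h : {poly_m L} =>
      npolyp m (\poly_(i < m) psi (h`_i / tnorm s' k i))) => g.
    apply/npolyP => i; rewrite coef_npolyp coef_poly coefG mulfK // phiK.
    by case: ltnP => // le_m; rewrite big_coef_npoly.
  apply/npolyP => i; rewrite coefG coef_npolyp coef_poly.
  case: ltnP => [|le_m]; first by rewrite psiK divfK.
  by rewrite rmorph0 mul0r big_coef_npoly.
- by apply/npolyP => i; rewrite !(coefD, coefZ, coefG) rmorphD rmorphM phi_alg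
       mulrDl mulrA.
rewrite (mono_sum g) (mono_sum h) petit_suml // !G_sum petit_suml //.
apply: eq_bigr => i _; rewrite !petit_sumr // G_sum.
apply: eq_bigr => j _; rewrite !G_mono //.
have [lt_m | le_m] := ltnP (i + j) m.
  rewrite !mono_mul // G_mono // tnormD !iter_rmorphM rmorphM phi_iter.
  by rewrite mulrACA mulrA.
have lt_e : (i + j - m < m)%N.
  by rewrite -(ltn_add2r m) subnK // -addnS leq_add // ltnW.
rewrite !mono_mul_wrap // G_mono // !rmorphM !phi_iter phi_d !iter_rmorphM.
have def_n : tnorm s' k i * iter i s' (tnorm s' k j) =
    tnorm s' k (i + j - m) * iter (i + j - m) s' (tnorm s' k m).
  by rewrite -!tnormD subnK.
congr (mono m _ _).
by rewrite [X in _ = X * _]mulrACA def_n [LHS]mulrAC !mulrA.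
Qed.

End PetitIsomorphism.

Section LeftNucleus.

Variables (F : fieldType) (m : nat) (K : fieldExtType F).
Variables (s : {rmorphism K -> K}) (a : K).
Hypothesis m_gt1 : (1 < m)%N.
Let m_gt0 : (0 < m)%N. Proof. exact: ltnW. Qed.
Implicit Types (g h x y z : {poly_m K}) (c : K).

Local Notation "g ** h" := (petit_mul s a g h) (at level 40).

Lemma petit_mul_const c g : mono m c 0 ** g = c *: g.
Proof.
rewrite [in LHS](mono_sum g) petit_sumr //; apply/npolyP => i.
rewrite coefn_sum coefZ; case: (ltnP i m) => [lt_i | le_i].
  rewrite (bigD1 (Ordinal lt_i)) //= mono_mul // coef_mono // eqxx big1 ?addr0
    //.
  move=> j; rewrite -val_eqE /= eq_sym => ne_j.
  by rewrite mono_mul ?add0n // coef_mono // (negPf ne_j).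
rewrite big_coef_npoly // mulr0 big1 // => j _; exact: big_coef_npoly.
Qed.

Lemma petit_mulZl c g h : (c *: g) ** h = c *: (g ** h).
Proof.
apply/val_inj; rewrite /= !petit_mulE // scaler_sumr; apply: eq_bigr => i _.
rewrite scaler_sumr; apply: eq_bigr => j _.
by rewrite coefZ scalerA mulrA.
Qed.

(** The converse of [left_nucleus_const] below: multiplication on the left by a
    constant is the scaling of the [K]-space [{poly_m K}]. *)
Lemma const_in_left_nucleus c y z :
  (mono m c 0 ** y) ** z = mono m c 0 ** (y ** z).
Proof. by rewrite !petit_mul_const petit_mulZl. Qed.

(** The associators [(t^i, t^(m-1), t)], for [0 < i], are the nonzero multiples
    [s^(i-1)(a) - s^i(a)] of [t^i]; as associators are left linear in their
    first argument, they detect all the coefficients but the constant one. *)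
Lemma left_nucleus_const x : s a != a ->
  (forall y z, (x ** y) ** z = x ** (y ** z)) -> x = mono m x`_0 0.
Proof.
move=> s_a nuc_x; apply/npolyP => i; rewrite coef_mono //.
case: eqP => [-> // | /eqP]; rewrite -lt0n => i_gt0.
have [lt_i | le_i] := ltnP i m; last by rewrite big_coef_npoly.
have lt_m1 : (m.-1 < m)%N by rewrite prednK.
set xi := LHS.
have := nuc_x (mono m 1 m.-1) (mono m 1 1).
rewrite [mono m 1 m.-1 ** _]mono_mul_wrap // ?addn1 ?prednK // subnn.
rewrite iter_rmorph1 !mul1r /= (mono_sum x) !petit_suml //.
move/(congr1 (fun g : {poly_m K} => g`_i)); rewrite !coefn_sum.
have predE (j : nat) : j != 0%N -> (j + m.-1 - m = j.-1)%N.
  case: j => // n _; rewrite addSnnS prednK // addnK //.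
rewrite (bigD1 (Ordinal lt_i)) //= [X in _ + X = _]big1 ?addr0; last first.
  move=> j; rewrite -val_eqE /= => ne_ij.
  have [j0 | nz_j] := eqVneq (j : nat) 0%N.
    rewrite j0 mono_mul // add0n mono_mul_wrap // ?addn1 ?prednK // subnn.
    by rewrite coef_mono // gtn_eqF.
  rewrite mono_mul_wrap // ?predE //; last first.
    by rewrite -ltnS -addnS prednK // -[X in (X < _)%N]add0n ltn_add2r lt0n.
  have ltj: (j.-1 + 1 < m)%N by rewrite addn1 prednK ?lt0n.
  rewrite mono_mul // coef_mono // addn1 prednK ?lt0n // eq_sym.
  by rewrite (negPf ne_ij).
rewrite [RHS](bigD1 (Ordinal lt_i)) //= [X in _ = _ + X]big1 ?addr0; last first.
  move=> j; rewrite -val_eqE /= eq_sym => ne_ij.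
  by rewrite mono_mul ?addn0 // coef_mono // (negPf ne_ij).
have ltj: (i.-1 + 1 < m)%N by rewrite addn1 prednK.
rewrite mono_mul_wrap //; last first.
  by rewrite -ltnS -addnS prednK // -[X in (X < _)%N]add0n ltn_add2r.
rewrite predE -?lt0n //= mono_mul // coef_mono //.
rewrite mono_mul ?addn0 // coef_mono // addn1 prednK // eqxx !iter_rmorph1
  !mulr1.
rewrite -[in iter i s a](prednK i_gt0) iterSr => /eqP;
  rewrite -subr_eq0 -mulrBr.
rewrite mulf_eq0 => /orP[/eqP<- // | ].
have -> : iter i.-1 s a - iter i.-1 s (s a) = iter i.-1 s (a - s a).
  by elim: i.-1 => //= n <-; rewrite rmorphB.
by rewrite iter_rmorph_eq0 subr_eq0 eq_sym (negPf s_a).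
Qed.

Lemma petit_nonassociative : s a != a -> ~ associative (@petit_mul F m K s a).
Proof.
move=> s_a assoc; have := left_nucleus_const s_a (fun y z =>
  esym (assoc (mono m 1 1) y z)).
move/(congr1 (fun g : {poly_m K} => g`_1)); rewrite !coef_mono //= => /eqP.
by rewrite oner_eq0.
Qed.

End LeftNucleus.

(** * Rigidity of isomorphisms *)

Section IsomorphismRigidity.

Variables (F : fieldType) (m : nat) (K L : fieldExtType F).
Variables (s : {rmorphism K -> K}) (d : K) (s' : {rmorphism L -> L}) (a : L).
Hypotheses (m_gt1 : (1 < m)%N) (s'_a : s' a != a).
Let m_gt0 : (0 < m)%N. Proof. exact: ltnW. Qed.

Lemma coef_petit_mul_const_r (g : {poly_m L}) c i :
  (petit_mul s' a g (mono m c 0))`_i = g`_i * iter i s' c.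
Proof.
have [lt_i | le_i] := ltnP i m; last by rewrite !big_coef_npoly ?mul0r.
rewrite [in LHS](mono_sum g) petit_suml // coefn_sum (bigD1 (Ordinal lt_i)) //=.
rewrite mono_mul ?addn0 // coef_mono // eqxx big1 ?addr0 // => j.
rewrite -val_eqE /= eq_sym => ne_ij.
by rewrite mono_mul ?addn0 // coef_mono // (negPf ne_ij).
Qed.

Variable G : {poly_m K} -> {poly_m L}.
Hypothesis G_bij : bijective G.
Hypothesis G_linear :
  forall (c : F) g h, G (c%:A *: g + h) = c%:A *: G g + G h.
Hypothesis GM : forall g h, G (petit_mul s d g h) = petit_mul s' a (G g) (G h).

Let GD g h : G (g + h) = G g + G h.
Proof. by have := G_linear 1 g h; rewrite !scale1r. Qed.

Let G0 : G 0 = 0.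
Proof. by apply: (addrI (G 0)); rewrite -GD !addr0. Qed.

Let GB g h : G (g - h) = G g - G h.
Proof. by apply: (addIr (G h)); rewrite -GD !subrK. Qed.

(** An isomorphism carries the left nucleus [K] of the first algebra into the
    left nucleus of the second one, which is [L]. *)
Lemma iso_restricts_to_constants :
  exists rho : {rmorphism K -> L},
    (forall c, G (mono m c 0) = mono m (rho c) 0) /\
    (forall c : F, rho c%:A = c%:A).
Proof.
have [H GK HK] := G_bij.
pose rho c := (G (mono m c 0))`_0.
have G_const c : G (mono m c 0) = mono m (rho c) 0.
  apply: (left_nucleus_const m_gt1 s'_a) => y z.
  by rewrite -(HK y) -(HK z) -!GM const_in_left_nucleus.
have rho1 : rho 1 = 1.
  have := GM (mono m 1 0) (H (mono m 1 0)).
  rewrite petit_mul_const // scale1r HK G_const petit_mul_const //.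
  move/(congr1 (fun g : {poly_m L} => g`_0)); rewrite coefZ !coef_mono // eqxx.
  by rewrite mulr1.
have rhoB : zmod_morphism rho.
  move=> x y; have def_xy : mono m (x - y) 0 = mono m x 0 - mono m y 0.
    by apply: (addIr (mono m y 0)); rewrite -monoD !subrK.
  by rewrite /rho def_xy GB coefB.
have rhoM : monoid_morphism rho.
  split=> // x y; rewrite {1}/rho.
  have -> : mono m (x * y) 0 = petit_mul s d (mono m x 0) (mono m y 0).
    by rewrite mono_mul.
  by rewrite GM !G_const mono_mul // coef_mono.
have rhoR : {rho' : {rmorphism K -> L} | rho' =1 rho}.
  pose R : {rmorphism K -> L} := HB.pack rho
    (GRing.isZmodMorphism.Build _ _ rho rhoB)
    (GRing.isMonoidMorphism.Build _ _ rho rhoM).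
  by exists R.
have [rho' def_rho] := rhoR; exists rho'; split=> c; rewrite def_rho //.
have -> : rho c%:A = (G (c%:A *: mono m 1 0 + 0))`_0.
  rewrite addr0 /rho; congr (G _)`_0; apply/npolyP => i.
  by rewrite coefZ !coef_mono //; case: eqP; rewrite ?mulr1 ?mulr0.
by rewrite G_linear G0 addr0 G_const rho1 coefZ coef_mono // mulr1.
Qed.

Variable rho : {rmorphism K -> L}.
Hypothesis G_const : forall c, G (mono m c 0) = mono m (rho c) 0.

(** The relation [t^j c = s^j(c) t^j] is preserved by [G]: the image of [t^j] is
    an eigenvector for [L], hence lives in the degrees [i] where [s'^i]
    corresponds to [s^j]. *)
Lemma iso_twisted_commutation j c i : (j < m)%N ->
  (G (mono m 1 j))`_i * iter i s' (rho c)
    = rho (iter j s c) * (G (mono m 1 j))`_i.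
Proof.
move=> lt_j; set g := G _; rewrite -coef_petit_mul_const_r.
have <- : (petit_mul s' a (mono m (rho (iter j s c)) 0) g)`_i =
    rho (iter j s c) * g`_i by rewrite petit_mul_const // coefZ.
by rewrite -!G_const -!GM !mono_mul ?addn0 // !mul1r iter_rmorph1 mulr1.
Qed.

Lemma iso_mono_neq0 j : (j < m)%N -> G (mono m 1 j) != 0.
Proof.
move=> lt_j; apply/eqP; rewrite -G0 => /(bij_inj G_bij).
move/(congr1 (fun g : {poly_m K} => g`_j)).
by rewrite coef_mono // coef0 eqxx => /eqP; rewrite oner_eq0.
Qed.

(** The associators [(t, t^j, z)] vanish for [j + 1 < m], whereas
    [(t^i, t^(m-1), t)] does not for [0 < i]: this distinguishes the degree
    [m - 1] from the lower ones. *)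
Lemma iso_top_degree i j l k1 k2 k3 :
    (0 < i < m)%N -> (j.+1 < m)%N -> (l < m)%N ->
    k1 != 0 -> k2 != 0 -> k3 != 0 -> iter m s' k3 = k3 ->
    G (mono m 1 1) = mono m k1 i -> G (mono m 1 j) = mono m k2 m.-1 ->
    G (mono m 1 l) = mono m k3 1 ->
  False.
Proof.
move=> /andP[i_gt0 lt_i] lt_j lt_l nz1 nz2 nz3 fix3 G1 Gj Gl.
have lt_m1 : (m.-1 < m)%N by rewrite prednK.
have assoc : petit_mul s d (petit_mul s d (mono m 1 1) (mono m 1 j)) (mono m 1
  l)
    = petit_mul s d (mono m 1 1) (petit_mul s d (mono m 1 j) (mono m 1 l)).
  have lt_j' := ltnW lt_j.
  rewrite [petit_mul s d (mono m 1 1) (mono m 1 j)]mono_mul //.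
  rewrite !iter_rmorph1 !mulr1 add1n.
  have [lt_jl | le_jl] := ltnP (j + l) m.
    rewrite [petit_mul s d (mono m 1 j) _]mono_mul // iter_rmorph1 mulr1.
    have [lt_jl1 | le_jl1] := ltnP (j.+1 + l) m.
      by rewrite !mono_mul ?add1n // !iter_rmorph1 mulr1.
    by rewrite !mono_mul_wrap ?add1n // !iter_rmorph1 !mulr1 !mul1r.
  rewrite [petit_mul s d (mono m 1 j) _]mono_mul_wrap // iter_rmorph1 !mul1r.
  have lt_e : (j + l - m < l)%N.
    by rewrite ltn_subLR // ltn_add2r.
  rewrite mono_mul_wrap ?mono_mul ?add1n //; first last.
  - by rewrite (leq_trans le_jl) // leq_add2r.
  - exact: leq_ltn_trans lt_e lt_l.
  by rewrite addSn subSn // !iter_rmorph1 !mul1r.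
have := congr1 G assoc; rewrite !GM G1 Gj Gl.
rewrite [petit_mul s' a (mono m k2 _) _]mono_mul_wrap // ?addn1 ?prednK //
  subnn.
have le_im : (m <= i + m.-1)%N.
  by rewrite -ltnS -addnS prednK // -[X in (X < _)%N]add0n ltn_add2r.
have def_e : (i + m.-1 - m = i.-1)%N.
  by rewrite -[in LHS](prednK i_gt0) addSnnS prednK // addnK.
rewrite [petit_mul s' a (mono m k1 i) (mono m k2 _)]mono_mul_wrap // def_e.
rewrite !mono_mul ?addn0 ?addn1 ?prednK //.
move/(congr1 (fun g : {poly_m L} => g`_i));
  rewrite !coef_mono // eqxx !iter_rmorphM.
rewrite -!iterD addn0 [(i + m.-1)%N]addnC.
have -> : iter (m.-1 + i) s' k3 = iter i.-1 s' k3.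
  by rewrite -{1}(prednK i_gt0) addnS -addSn prednK // addnC iterD fix3.
rewrite -!mulrA => /(mulfI nz1)/mulfI; rewrite iter_rmorph_eq0 => /(_ nz2).
rewrite mulrC => /mulfI; rewrite iter_rmorph_eq0 => /(_ nz3)/eqP.
rewrite -[in iter i s' a](prednK i_gt0) iterSr -subr_eq0 /=.
have -> : iter i.-1 s' a - iter i.-1 s' (s' a) = iter i.-1 s' (a - s' a).
  by elim: i.-1 => //= n <-; rewrite rmorphB.
by rewrite iter_rmorph_eq0 subr_eq0 eq_sym (negPf s'_a).
Qed.

Lemma iso_tnorm k : G (mono m 1 1) = mono m k 1 -> rho d = tnorm s' k m * a.
Proof.
move=> G1.
have Gj j : (j < m)%N -> G (mono m 1 j) = mono m (tnorm s' k j) j.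
  elim: j => [|j IHj] lt_j; first by rewrite G_const rmorph1 tnorm0.
  have -> : mono m 1 j.+1 = petit_mul s d (mono m 1 1) (mono m 1 j).
    by rewrite mono_mul // iter_rmorph1 mulr1.
  by rewrite GM G1 IHj ?(ltnW lt_j) // mono_mul // tnormS.
(* The image of t * t^(m-1) = d. *)
have lt_m1 : (m.-1 < m)%N by rewrite prednK.
have := GM (mono m 1 1) (mono m 1 m.-1); rewrite G1 Gj //.
rewrite !mono_mul_wrap ?add1n ?prednK // subnn iter_rmorph1 !mul1r /=.
rewrite G_const -tnormS prednK //.
by move/(congr1 (fun g : {poly_m L} => g`_0)); rewrite !coef_mono.
Qed.

End IsomorphismRigidity.

(** * Radical generators of cyclic extensions of finite fields *)

Lemma primitive_root_neq0 (F : fieldType) m (z : F) : m.-primitive_root z ->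
  z != 0.
Proof.
move=> z_prim; have := expf_eq0 z m.
by rewrite (prim_expr_order z_prim) oner_eq0 (prim_order_gt0 z_prim) =>
  /esym/negbT.
Qed.

Lemma prime_primitive_root (F : fieldType) m (z : F) :
  prime m -> z ^+ m = 1 -> z != 1 -> m.-primitive_root z.
Proof.
move=> m_prime z_m z_neq1.
have [k prim_k] := prim_order_exists (prime_gt0 m_prime) z_m.
case/primeP: m_prime => _ prime_dv /prime_dv/orP[] /eqP def_k;
  last by rewrite -def_k.
by rewrite def_k in prim_k;
  rewrite -(prim_expr_order prim_k) expr1 eqxx in z_neq1.
Qed.

Lemma scalar_inj (F : fieldType) (K : fieldExtType F) :
  injective (fun c : F => c%:A : K).
Proof. exact: (fmorph_inj (in_alg K)). Qed.

Section PrimePowerClasses.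

Variables (F : finFieldType) (m : nat) (e : F).
Hypotheses (m_prime : prime m) (e_neq0 : e != 0).
Hypothesis e_npow : forall c : F, c ^+ m <> e.

(** The multiplicative group of [F] is cyclic, so that its quotient by the
    [m]-th powers is cyclic of order [m], and generated by any nontrivial
    class. *)
Lemma nonpower_generates c : c != 0 -> exists u f, c = e ^+ u * f ^+ m.
Proof.
have [g gen_g] : exists g : F, forall x, x != 0 -> exists n, x = g ^+ n.
  have /cyclicP[g def_g] := field_unit_group_cyclic [set: {unit F}]%G.
  exists (FinRing.uval g) => x; rewrite -unitfE => Ux.
  have /cycleP[n def_x] : FinRing.unit F Ux \in <[g]>%g by rewrite -def_g inE.
  by exists n; rewrite -FinRing.val_unitX -def_x.
case/gen_g=> l def_c; have [n def_e] := gen_g e e_neq0.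
have g_neq0 : g != 0.
  apply: contra_neq e_neq0 => g0; move: (@e_npow 1); rewrite expr1n def_e g0.
  by case: n {def_e} => [//|n] _; rewrite expr0n.
have n_co_m : coprime n m.
  rewrite coprime_sym prime_coprime //; apply/negP=> /dvdnP[q def_n].
  by apply: (@e_npow (g ^+ q)); rewrite -exprM -def_n.
have n_gt0 : (0 < n)%N.
  by case: n n_co_m {def_e} => //; rewrite /coprime gcd0n;
    case: m m_prime => [|[]].
have [km kn def_k _] := egcdnP m n_gt0; rewrite (eqP n_co_m) in def_k.
exists (km * l)%N, (g ^- (kn * l)); rewrite def_c def_e -exprM exprVn -exprM.
have -> : (n * (km * l) = kn * l * m + l)%N.
  by rewrite mulnA [(n * km)%N]mulnC def_k mulnDl mul1n mulnAC.
by rewrite exprD mulrAC mulfV ?mul1r // expf_neq0.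
Qed.
End PrimePowerClasses.

Section CyclicExtension.

Variables (F : finFieldType) (m : nat) (K : splittingFieldType F).
Variable tau : gal_of {:K}.
Hypothesis tau_gen : cyclic_generator m tau.

Lemma gal_expgE n x : (tau ^+ n)%g x = iter n tau x.
Proof.
elim: n x => [|n IHn] x; first by rewrite expg0 gal_id.
by rewrite expgSr galM ?memvf // IHn.
Qed.

Lemma gal_generator_orderE : #[tau]%g = m.
Proof.
have [dim_K gal_K /eqP gen] := tau_gen.
by rewrite /order -gen -galois_dim // dimv1 divn1.
Qed.

Lemma gal_iter_period x : iter m tau x = x.
Proof. by rewrite -gal_expgE -gal_generator_orderE expg_order gal_id. Qed.

Lemma gal_fixed_scalar x : tau x = x -> exists c : F, x = c%:A.
Proof.
have [dim_K gal_K /eqP gen] := tau_gen => tau_x.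
suff /vlineP[c ->] : x \in 1%VS by exists c.
rewrite -[1%VS](galois_fixedField gal_K); apply/fixedFieldP;
  rewrite ?memvf // => y.
rewrite gen => /cycleP[n ->]; rewrite gal_expgE.
by elim: n => //= n ->.
Qed.

Lemma gal_scalar c : tau c%:A = c%:A.
Proof. by rewrite linearZ /= rmorph1. Qed.

Variables (zeta b : F).
Hypotheses (m_prime : prime m) (zeta_prim : m.-primitive_root zeta).

Lemma scalar_root_of_unity (x : K) : x ^+ m = 1 -> exists r, x = (zeta ^+ r)%:A.
Proof.
have zeta_prim' : m.-primitive_root (in_alg K zeta)
  by rewrite fmorph_primitive_root.
by case/(prim_rootP zeta_prim') => r ->; exists r; rewrite -rmorphXn.
Qed.

Lemma gal_radical_eigen y (c : F) :
  y ^+ m = c%:A -> exists r, tau y = zeta ^+ r *: y.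
Proof.
move=> y_m; have [-> | nz_y] := eqVneq y 0.
  by exists 0%N; rewrite rmorph0 scaler0.
have [|r def_r] := @scalar_root_of_unity (tau y / y).
  by rewrite expr_div_n -rmorphXn y_m /= gal_scalar divff // -y_m expf_neq0.
by exists r; rewrite -mulr_algl -def_r divfK.
Qed.

Hypotheses (b_neq0 : b != 0) (b_npow : forall c : F, c ^+ m <> b).

(** Hilbert's Theorem 90, applied to the norm one element [zeta], gives a
    radical generator of [K]; multiplying a power of it by a scalar turns its
    [m]-th power into [b]. *)
Lemma radical_generator : exists beta r,
  [/\ beta ^+ m = b%:A, tau beta = zeta ^+ r *: beta & zeta ^+ r != 1].
Proof.
have [dim_K gal_K gen] := tau_gen.
have m_gt0 := prime_gt0 m_prime.
have norm1 : galNorm 1%AS {:K} (zeta%:A : K) == 1.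
  rewrite /galNorm (eq_bigr (fun _ => zeta%:A)) => [|x _]; last first.
    by rewrite linearZ /= rmorph1.
  rewrite prodr_const -galois_dim // dimv1 divn1 dim_K.
  by rewrite -[zeta%:A]/(in_alg K zeta) -rmorphXn prim_expr_order // rmorph1.
have [y [_ nz_y] def_zeta] :=
  Hilbert's_theorem_90 gen (memvf (zeta%:A : K)) norm1.
have tau_y_neq0 : tau y != 0 by rewrite fmorph_eq0.
have [e def_e] : exists e : F, y ^+ m = e%:A.
  apply: gal_fixed_scalar; rewrite rmorphXn; apply/eqP.
  rewrite eq_sym -(inj_eq (mulIf (invr_neq0 (expf_neq0 m tau_y_neq0)))).
  rewrite divff ?expf_neq0 // -expr_div_n -def_zeta -[zeta%:A]/(in_alg K zeta).
  by rewrite -rmorphXn prim_expr_order // rmorph1.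
have inj_K := @scalar_inj F K.
have e_neq0 : e != 0.
  apply: contra_neq nz_y => e0; have := expf_eq0 y m.
  by rewrite def_e e0 scale0r eqxx m_gt0 => /esym/eqP.
have e_npow c : c ^+ m <> e.
  move=> def_c; have nz_c : c != 0.
    by apply: contra_neq e_neq0 => c0; rewrite -def_c c0 expr0n gtn_eqF.
  have nz_cA : c%:A != 0 :> K by rewrite -[c%:A]/(in_alg K c) fmorph_eq0.
  have [|r def_r] := @scalar_root_of_unity (y / c%:A).
    by rewrite expr_div_n def_e -![_%:A]/(in_alg K _) -rmorphXn def_c divff
      ?fmorph_eq0.
  have def_y : y = (zeta ^+ r * c)%:A.
    by rewrite -[RHS]/(in_alg K _) rmorphM /= -def_r divfK.
  have zeta1 : zeta = 1.
    apply: inj_K; rewrite /= def_zeta.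
    by rewrite [tau y](_ : _ = y) ?divff ?scale1r // def_y gal_scalar.
  have := prime_gt1 m_prime; rewrite ltnNge => /negP[].
  by apply: dvdn_leq => //; rewrite (prim_order_dvd zeta_prim) zeta1.
have [u [f def_b]] := nonpower_generates m_prime e_neq0 e_npow b_neq0.
pose beta := y ^+ u * f%:A.
have beta_m : beta ^+ m = b%:A.
  rewrite /beta exprMn -exprM mulnC exprM def_e -![_%:A]/(in_alg K _)
    -!rmorphXn.
  by rewrite -rmorphM -def_b.
have [r tau_beta] := gal_radical_eigen beta_m.
exists beta, r; split=> //; apply/eqP => zeta_r1.
have [|c def_c] := @gal_fixed_scalar beta;
  first by rewrite tau_beta zeta_r1 scale1r.
apply: (@b_npow c); apply: inj_K.
by rewrite /= -beta_m def_c -![_%:A]/(in_alg K _) rmorphXn.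
Qed.
End CyclicExtension.

(** * Coordinates with respect to a radical generator *)

Section RadicalBasis.

Variables (F : fieldType) (m : nat) (K : fieldExtType F) (b : F) (y : K).
Hypotheses (m_prime : prime m) (dim_K : \dim {:K} = m).
Hypotheses (y_m : y ^+ m = b%:A) (y_notin : y \notin 1%VS).

Let adjoin_degree_radical : adjoin_degree 1 y = m.
Proof.
have := field_dimS (subvf <<1; y>>%AS); rewrite dim_Fadjoin dimv1 muln1 dim_K.
case/primeP: m_prime => _ prime_dv /prime_dv/orP[|/eqP//].
by rewrite adjoin_deg_eq1 (negPf y_notin).
Qed.

Let horner_algE (p : {poly F}) : horner_alg y p = (map_poly (in_alg K) p).[y].
Proof. by []. Qed.

(** Since [m] is prime, [y] generates [K], and its minimal polynomial has degree
    [m]: the powers [y^i] with [i < m] are a basis, of which this lemma gives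
    the freeness and the next one the generation. *)
Lemma radical_horner_inj (p : {poly F}) :
  (size p <= m)%N -> horner_alg y p = 0 -> p = 0.
Proof.
move=> le_pm py0; apply/eqP; apply: contraLR le_pm => nz_p.
have nz_p' : map_poly (in_alg K) p != 0 by rewrite map_poly_eq0.
have := @dvdp_leq _ (minPoly 1 y) _ nz_p'.
rewrite size_minPoly adjoin_degree_radical size_map_poly -ltnNge; apply.
apply: minPoly_dvdp; last by rewrite /root -horner_algE py0.
by apply/polyOver1P; exists p.
Qed.

Lemma radical_horner_surj (x : K) :
  exists p : {poly F}, (size p <= m)%N && (horner_alg y p == x).
Proof.
have x_in : x \in <<1; y>>%VS.
  suff -> : <<1; y>>%VS = {:K}%VS by rewrite memvf.
  apply/eqP; rewrite eqEdim subvf dim_Fadjoin dimv1 muln1 dim_K.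
  by rewrite adjoin_degree_radical /=.
have /polyOver1P[p def_p] := Fadjoin_polyOver 1 y x.
exists p; rewrite horner_algE -def_p Fadjoin_poly_eq // eqxx andbT.
by rewrite -(size_map_poly (in_alg K)) -def_p -adjoin_degree_radical
  size_Fadjoin_poly.
Qed.

Lemma radical_horner_eq0 (p : {poly F}) :
  (horner_alg y p == 0) = ('X^m - b%:P %| p).
Proof.
have m_gt0 := prime_gt0 m_prime.
have mon : 'X^m - b%:P \is monic by exact: monicXnsubC.
have y_root : horner_alg y ('X^m - b%:P) = 0.
  by rewrite rmorphB rmorphXn /= horner_algX horner_algC y_m subrr.
rewrite [in LHS](divp_eq p ('X^m - b%:P)) rmorphD rmorphM /= y_root mulr0 add0r.
apply/eqP/idP => [|/eqP->]; last by rewrite rmorph0.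
move/radical_horner_inj => r0; apply/eqP/r0.
by rewrite -ltnS -(size_XnsubC b m_gt0) ltn_modp monic_neq0.
Qed.

Definition radical_poly (x : K) : {poly F} := xchoose (radical_horner_surj x).

Lemma radical_polyK x : horner_alg y (radical_poly x) = x.
Proof. by case/andP: (xchooseP (radical_horner_surj x)) => _ /eqP. Qed.

End RadicalBasis.

Section RadicalTransfer.

Variables (F : fieldType) (m : nat) (K L : fieldExtType F) (b : F) (y : K) (z
  : L).
Hypotheses (m_prime : prime m) (dim_K : \dim {:K} = m) (dim_L : \dim {:L} = m).
Hypotheses (y_m : y ^+ m = b%:A) (y_notin : y \notin 1%VS).
Hypotheses (z_m : z ^+ m = b%:A) (z_notin : z \notin 1%VS).

(** Both fields are the quotient of [F[X]] by [X^m - b]; sending [y] to [z], for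
    a choice of the root [z], leaves the freedom of an automorphism of [L]. *)
Lemma radical_transfer : exists phi : {rmorphism K -> L},
  bijective phi /\ forall p : {poly F}, phi (horner_alg y p) = horner_alg z p.
Proof.
pose repK := radical_poly m_prime dim_K y_notin.
pose repL := radical_poly m_prime dim_L z_notin.
pose phi x := horner_alg z (repK x); pose psi x := horner_alg y (repL x).
have eq_horner p q : (horner_alg y p == horner_alg y q) = (horner_alg z p ==
  horner_alg z q).
  rewrite -!(subr_eq0 (horner_alg _ p)) -!rmorphB.
  rewrite (radical_horner_eq0 m_prime dim_K y_m y_notin).
  by rewrite (radical_horner_eq0 m_prime dim_L z_m z_notin).
have phiE p : phi (horner_alg y p) = horner_alg z p.
  by apply/eqP; rewrite /phi -eq_horner radical_polyK.
have psiE p : psi (horner_alg z p) = horner_alg y p.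
  by apply/eqP; rewrite /psi eq_horner radical_polyK.
have phi_rep x : x = horner_alg y (repK x) by rewrite radical_polyK.
have phiB : zmod_morphism phi.
  by move=> u v; rewrite (phi_rep u) (phi_rep v) -rmorphB !phiE rmorphB.
have phiM : monoid_morphism phi.
  split=> [|u v]; first by rewrite -(rmorph1 (horner_alg y)) phiE rmorph1.
  by rewrite (phi_rep u) (phi_rep v) -rmorphM !phiE rmorphM.
pose phiR : {rmorphism K -> L} := HB.pack phi
  (GRing.isZmodMorphism.Build _ _ phi phiB)
  (GRing.isMonoidMorphism.Build _ _ phi phiM).
exists phiR; split; last exact: phiE.
exists psi => x /=; first by rewrite [x]phi_rep phiE psiE.
have -> : x = horner_alg z (repL x) by rewrite radical_polyK.
by rewrite psiE phiE.
Qed.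

End RadicalTransfer.

Section RadicalEndomorphisms.

Variables (F : fieldType) (K L : fieldExtType F).

Lemma rmorph_horner_alg (phi : {rmorphism K -> L}) (y : K) (p : {poly F}) :
    (forall c : F, phi c%:A = c%:A) ->
  phi (horner_alg y p) = horner_alg (phi y) p.
Proof.
move=> phi_alg; rewrite /horner_alg /horner_morph -horner_map -map_poly_comp.
by congr (_.[_]); apply: eq_map_poly => c /=; rewrite phi_alg.
Qed.

Lemma horner_alg_sum (y : K) (p : {poly F}) n : (size p <= n)%N ->
  horner_alg y p = \sum_(i < n) p`_i *: y ^+ i.
Proof.
move=> le_pn; rewrite /horner_alg /horner_morph (@horner_coef_wide _ n)
  ?size_map_poly //.
by apply: eq_bigr => i _; rewrite coef_map mulr_algl.
Qed.

Lemma horner_alg_scale (y : K) (c : F) (p : {poly F}) :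
  horner_alg (c *: y) p = horner_alg y (\poly_(i < size p) (c ^+ i * p`_i)).
Proof.
rewrite (@horner_alg_sum _ p _ (leqnn _)) (@horner_alg_sum _ _ (size p))
  ?size_poly //.
apply: eq_bigr => i _; rewrite coef_poly ltn_ord exprZn scalerA.
by rewrite mulrC.
Qed.

End RadicalEndomorphisms.

Section RadicalNorm.

Variables (F : finFieldType) (m : nat) (L : fieldExtType F) (s : {rmorphism L
  -> L}).
Variables (zeta b : F) (r : nat) (beta : L).
Hypotheses (m_prime : prime m) (m_odd : odd m) (zeta_m : zeta ^+ m = 1).
Hypotheses (b_neq0 : b != 0) (b_npow : forall c : F, c ^+ m <> b).
Hypotheses (beta_m : beta ^+ m = b%:A) (s_beta : s beta = zeta ^+ r *: beta).
Hypothesis s_scalar : forall c : F, s c%:A = c%:A.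

Let s_Z c x : s (c *: x) = c *: s x.
Proof. by rewrite -mulr_algl rmorphM s_scalar mulr_algl. Qed.

Lemma tnorm_scalar (c : F) : tnorm s c%:A m = (c ^+ m)%:A.
Proof.
rewrite /tnorm (eq_bigr (fun _ => c%:A)) => [|i _];
  last by elim: (i : nat) => //= n ->.
by rewrite prodr_const card_ord -[c%:A]/(in_alg L c) -rmorphXn.
Qed.

(** The norm of [beta] is the product of the [zeta^(r l) beta] for [l < m], and
    [0 + 1 + ... + (m - 1)] is a multiple of [m] when [m] is odd. *)
Lemma tnorm_radical : tnorm s beta m = b%:A.
Proof.
rewrite /tnorm (eq_bigr (fun l : 'I_m => zeta ^+ (r * l) *: beta)); last first.
  move=> l _; elim: (l : nat) => [|n IHn]; first by rewrite muln0 scale1r.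
  by rewrite iterS IHn s_Z s_beta scalerA -exprD mulnS addnC.
rewrite scaler_prod prodr_const card_ord beta_m prodrXr -big_distrr /=.
rewrite -(big_mkord xpredT id) bin2_sum bin2odd // mulnCA exprM zeta_m expr1n.
by rewrite scale1r.
Qed.

(** The group of norms contains the [m]-th powers, which are the norms of
    scalars, and the nonpower [b]; by [nonpower_generates], it is everything. *)
Lemma tnorm_surjective (c : F) : c != 0 ->
  exists2 k : L, k != 0 & tnorm s k m = c%:A.
Proof.
move=> nz_c.
have [u [f def_c]] := nonpower_generates m_prime b_neq0 b_npow nz_c.
have def_n : tnorm s (beta ^+ u * f%:A) m = c%:A.
  rewrite tnormM tnormX tnorm_radical tnorm_scalar -![_%:A]/(in_alg L _).
  by rewrite -rmorphXn -rmorphM -def_c.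
exists (beta ^+ u * f%:A) => //; apply: contra_neq nz_c => k0.
apply/eqP; rewrite -(fmorph_eq0 (in_alg L)) /= -def_n k0.
by rewrite tnorm_eq0 eqxx prime_gt0.
Qed.

End RadicalNorm.

(** * Supports and coset representatives *)

Section OrderedSupport.

Variables (F : fieldType) (m : nat).
Implicit Types (I : {set 'I_m}) (w : nat -> F) (p : {poly F}).

Lemma eltP I j : (j < #|I|)%N -> exists2 i : 'I_m, i \in I & val i = elt I j.
Proof.
rewrite cardE => lt_j.
have [i0 _] : exists i0 : 'I_m, true by case: (enum I) lt_j => // i s _;
  exists i.
exists (nth i0 (enum I) j); first by have := mem_nth i0 lt_j; rewrite mem_enum.
by rewrite /elt (nth_map i0).
Qed.

Lemma elt_ltn I j : (j < #|I|)%N -> (elt I j < m)%N.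
Proof. by case/eltP=> i _ <-; apply: ltn_ord. Qed.

Lemma mem_elt I (i : 'I_m) : i \in I -> exists2 j, (j < #|I|)%N & elt I j = i.
Proof.
move=> I_i; exists (index i (enum I));
  first by rewrite cardE index_mem mem_enum.
by rewrite /elt (nth_map i) ?index_mem ?mem_enum // nth_index ?mem_enum.
Qed.

Lemma elt_inj I j k : (j < #|I|)%N -> (k < #|I|)%N -> elt I j = elt I k ->
  j = k.
Proof.
move=> lt_j lt_k eq_e; case: (ltngtP j k) => // lt_jk.
  by have := elt_lt lt_jk lt_k; rewrite eq_e ltnn.
by have := elt_lt lt_jk lt_j; rewrite eq_e ltnn.
Qed.

Lemma elt0_leq I k : (k < #|I|)%N -> (elt I 0 <= elt I k)%N.
Proof. by case: k => // k lt_k; apply/ltnW/elt_lt. Qed.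

(** The elements attached to [I] are the values at the radical [beta] of such
    polynomials; coefficients, unlike values, can be compared one by one. *)
Definition spoly I w : {poly F} := \sum_(j < #|I|) w j *: 'X^(elt I j).

Lemma coef_spoly I w j : (j < #|I|)%N -> (spoly I w)`_(elt I j) = w j.
Proof.
move=> lt_j; rewrite coef_sum (bigD1 (Ordinal lt_j)) //= big1 => [|k].
  by rewrite coefZ coefXn eqxx mulr1 addr0.
rewrite -val_eqE /= coefZ coefXn => ne_kj; case: eqP => [/elt_inj eq_jk|_].
  by rewrite eq_jk ?eqxx in ne_kj.
by rewrite mulr0.
Qed.

Lemma coef_spoly_notin I w (i : 'I_m) : i \notin I -> (spoly I w)`_i = 0.
Proof.
move=> notI_i; rewrite coef_sum big1 // => j _; rewrite coefZ coefXn.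
have [k I_k def_k] := eltP (ltn_ord j); rewrite -def_k.
case: eqP => [/val_inj eq_ik|_]; last by rewrite mulr0.
by rewrite eq_ik I_k in notI_i.
Qed.

Lemma size_spoly I w : (size (spoly I w) <= m)%N.
Proof.
apply: (leq_trans (size_sum _ _ _)); apply/bigmax_leqP => j _.
by rewrite (leq_trans (size_scale_leq _ _)) // size_polyXn elt_ltn.
Qed.

Lemma spoly_support I w : (forall j, (j < #|I|)%N -> w j != 0) ->
  I = [set i : 'I_m | (spoly I w)`_i != 0].
Proof.
move=> nz_w; apply/setP=> i; rewrite inE.
have [I_i | notI_i] := boolP (i \in I); last by rewrite coef_spoly_notin ?eqxx.
by have [j lt_j <-] := mem_elt I_i; rewrite coef_spoly // nz_w.
Qed.

Lemma eq_spoly I w w' :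
  (forall j, (j < #|I|)%N -> w j = w' j) -> spoly I w = spoly I w'.
Proof. by move=> eq_w; apply: eq_bigr => j _; rewrite eq_w. Qed.

Lemma horner_spoly (L : fieldExtType F) (beta : L) I w : (0 < #|I|)%N ->
  horner_alg beta (spoly I w) =
  w 0%N *: beta ^+ elt I 0 + \sum_(j < kof I) w j.+1 *: beta ^+ elt I j.+1.
Proof.
move=> I_gt0; rewrite /spoly rmorph_sum.
rewrite (eq_bigr (fun j : 'I__ => w j *: beta ^+ elt I j)) => [|j _];
  last first.
  by rewrite -mul_polyC rmorphM rmorphXn /= horner_algC horner_algX mulr_algl.
rewrite -(big_mkord xpredT (fun j => w j *: beta ^+ elt I j)).
by rewrite big_ltn // big_add1 big_mkord.
Qed.

End OrderedSupport.

Section Representatives.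

Variables (F : finFieldType) (m : nat) (zeta : F).
Variable X : forall I : {set 'I_m}, {set {dffun forall _ : 'I_(kof I), {unit
  F}}}.
Hypotheses (m_gt0 : (0 < m)%N) (zeta_prim : m.-primitive_root zeta).
Hypothesis X_reps : coset_representatives zeta X.
Implicit Types (I : {set 'I_m}) (w : nat -> F) (p : {poly F}).

Local Notation units k := {dffun forall _ : 'I_k, {unit F}}.

(** As [zeta^m = 1], the exponents between 1 and [m] in the definition of
    [Delta] account for all the natural numbers [r]. *)
Lemma mem_Delta I (u v : units (kof I)) :
  reflect (exists r, forall j, FinRing.uval (u j) =
             zeta ^+ (r * (elt I j.+1 - elt I 0)) * FinRing.uval (v j))
          ((u * v^-1)%g \in Delta zeta I).
Proof.
have uvE j : FinRing.uval ((u * v^-1)%g j) = FinRing.uval (u j) / FinRing.uval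
  (v j).
  by rewrite !ffunE.
have nz_v j : FinRing.uval (v j) != 0 by rewrite -unitfE; case: (v j).
rewrite inE; apply: (iffP existsP) => [[s /forallP Ds] | [r def_u]].
  by exists s.+1 => j; have := Ds j; rewrite uvE => /eqP <-; rewrite divfK.
exists (Ordinal (ltn_pmod (r + m.-1) m_gt0)); apply/forallP => j.
rewrite uvE def_u mulfK // exprM [in X in _ == X]exprM; apply/eqP.
congr (_ ^+ _); rewrite /= exprSr (prim_expr_mod zeta_prim) -exprSr -addnS.
by rewrite prednK // exprD (prim_expr_order zeta_prim) mulr1.
Qed.

Lemma representative_exists I (v : units (kof I)) : (1 < #|I|)%N ->
  exists2 u, u \in X I & (u * v^-1)%g \in Delta zeta I.
Proof.
move=> /X_reps/and3P[_ _ /forall_inP X1].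
have /X1/cards1P[u def_u] : (Delta zeta I :* v)%g \in
    rcosets (Delta zeta I) [set: units (kof I)].
  by apply/rcosetsP; exists v.
have : u \in [set u] by rewrite inE.
by rewrite -def_u inE mem_rcoset => /andP[X_u Du]; exists u.
Qed.

Lemma representative_unique I (u v : units (kof I)) : (1 < #|I|)%N ->
  u \in X I -> v \in X I -> (u * v^-1)%g \in Delta zeta I -> u = v.
Proof.
move=> /X_reps/and3P[_ _ /forall_inP X1] X_u X_v Duv.
have /X1/cards1P[t def_t] : (Delta zeta I :* v)%g \in
    rcosets (Delta zeta I) [set: units (kof I)].
  by apply/rcosetsP; exists v.
have : u \in [set t] by rewrite -def_t inE X_u mem_rcoset.
have : v \in [set t].
  rewrite -def_t inE X_v mem_rcoset; apply/mem_Delta; exists 0%N => j.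
  by rewrite mul0n mul1r.
by rewrite !inE => /eqP-> /eqP->.
Qed.

(** [w j] is the coefficient at the [j]-th element of [I]. *)
Definition rep_weight I w : Prop :=
  [/\ w 0%N = 1, forall j, (j < #|I|)%N -> w j != 0
    & (1 < #|I|)%N -> exists2 u, u \in X I &
        forall j : 'I_(kof I), w j.+1 = FinRing.uval (u j)].

Lemma SL_spoly (L : fieldExtType F) (beta x : L) :
  SL beta X x <-> exists I w,
    [/\ I != set0, I != [set i : 'I_m | val i == 0%N], rep_weight I w
      & x = horner_alg beta (spoly I w)].
Proof.
split=> [[I [nz_I ne_I]] | [I [w [nz_I ne_I [w0 nz_w rep_w] ->]]]].
  have I_gt0 : (0 < #|I|)%N by rewrite card_gt0.
  rewrite /KI; case: eqP => [I1 -> | /eqP I_ne1 [u X_u ->]].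
    exists I, (fun _ => 1); split=> //.
      by split=> [//|j _|]; rewrite ?oner_eq0 // I1.
    by rewrite horner_spoly // /kof I1 big_ord0 addr0.
  pose w j : F := if j is j'.+1 then oapp (fun o =>
    FinRing.uval (u o)) 1 (insub j') else 1.
  have w_u (j : 'I_(kof I)) : w j.+1 = FinRing.uval (u j) by rewrite /= valK.
  exists I, w; split=> //.
    split=> // [j lt_j|_]; last by exists u.
    case: j lt_j => [|j]; first by rewrite oner_eq0.
    rewrite -ltn_predRL => lt_j;
      rewrite -[j]/(val (Ordinal lt_j : 'I_(kof I))) w_u.
    by rewrite -unitfE; case: (u _).
  by rewrite horner_spoly //; congr (_ + _); apply: eq_bigr => j _; rewrite w_u.
have I_gt0 : (0 < #|I|)%N by rewrite card_gt0.
exists I; split=> //; rewrite /KI horner_spoly // w0.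
case: eqP => [I1 | /eqP I_ne1]; first by rewrite /kof I1 big_ord0 addr0.
have [|u X_u w_u] := rep_w; first by rewrite ltn_neqAle eq_sym I_ne1.
by exists u => //; congr (_ + _); apply: eq_bigr => j _; rewrite w_u.
Qed.

(** The scalar factor brings the first coefficient to 1; the substitutions
    [X |-> zeta^r X] combined with this normalization then act on the other
    coefficients through [Delta]. *)
Lemma rep_weight_exists p (i : 'I_m) : (size p <= m)%N -> p`_i != 0 ->
  exists r c w, let I := [set j : 'I_m | p`_j != 0] in
    [/\ c != 0, rep_weight I w
      & forall j, zeta ^+ (r * j) * p`_j = c * (spoly I w)`_j].
Proof.
move=> le_pm nz_pi; set I := [set j : 'I_m | p`_j != 0].
have I_i : i \in I by rewrite inE.
have I_gt0 : (0 < #|I|)%N by apply/card_gt0P; exists i.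
have nz_p k : (k < #|I|)%N -> p`_(elt I k) != 0.
  by case/eltP=> j; rewrite inE => nz_pj <-.
have [r rep_r] : exists r, (1 < #|I|)%N -> exists2 u, u \in X I &
    forall j : 'I_(kof I), zeta ^+ (r * (elt I j.+1 - elt I 0)) *
      (p`_(elt I j.+1) / p`_(elt I 0)) = FinRing.uval (u j).
  case: (ltnP 1 #|I|) => [I_gt1 | _]; last by exists 0%N.
  have /fin_all_exists[v def_v] (j : 'I_(kof I)) : exists t : {unit F},
      FinRing.uval t = p`_(elt I j.+1) / p`_(elt I 0).
    have Ut : p`_(elt I j.+1) / p`_(elt I 0) \is a GRing.unit.
      by rewrite unitfE mulf_neq0 ?invr_eq0 ?nz_p // -ltn_predRL.
    by exists (FinRing.unit F Ut).
  have [u X_u /mem_Delta[r def_u]] :=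
    representative_exists (finfun v : units (kof I)) I_gt1.
  by exists r => _; exists u => // j; rewrite def_u ffunE def_v.
exists r, (zeta ^+ (r * elt I 0) * p`_(elt I 0)).
exists (fun k => zeta ^+ (r * (elt I k - elt I 0)) * (p`_(elt I k) / p`_(elt I
  0))).
have nz_z := expf_neq0 _ (primitive_root_neq0 zeta_prim).
split=> [|| j]; first by rewrite mulf_neq0 ?nz_p.
  split=> // [|j lt_j]; first by rewrite subnn muln0 mul1r divff ?nz_p.
  by rewrite !mulf_neq0 ?invr_eq0 ?nz_p.
have [lt_jm | le_mj] := ltnP j m; last first.
  rewrite (nth_default _ (leq_trans le_pm le_mj)) mulr0.
  by rewrite (nth_default _ (leq_trans (size_spoly _ _) le_mj)) mulr0.
have [I_j | notI_j] := boolP (Ordinal lt_jm \in I); last first.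
  rewrite -[j]/(val (Ordinal lt_jm)) coef_spoly_notin //.
  by move: notI_j; rewrite inE negbK => /eqP->; rewrite !mulr0.
have [k lt_k] := mem_elt I_j; rewrite /= => <-; rewrite coef_spoly //.
rewrite mulrACA -exprD -mulnDr subnKC ?elt0_leq //.
by congr (_ * _); rewrite mulrCA divff ?nz_p // mulr1.
Qed.

(** Comparing the first coefficients, both equal to 1, gives the scalar factor
    [c = zeta^(r i_0)]; the other ones then differ by an element of [Delta]. *)
Lemma rep_weight_unique I I' w w' r c :
    (0 < #|I|)%N -> c != 0 -> rep_weight I w -> rep_weight I' w' ->
    (forall j, (j < m)%N ->
      zeta ^+ (r * j) * (spoly I w)`_j = c * (spoly I' w')`_j) ->
  spoly I w = spoly I' w'.
Proof.
move=> I_gt0 nz_c [w0 nz_w rep_w] [w'0 nz_w' rep_w'] eq_ww'.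
have nz_z := expf_neq0 _ (primitive_root_neq0 zeta_prim).
have def_I' : I' = I.
  rewrite (spoly_support nz_w) (spoly_support nz_w'); apply/setP=> i;
    rewrite !inE.
  have /(congr1 (fun x => x == 0)) := eq_ww' i (ltn_ord i).
  by rewrite !mulf_eq0 (negPf nz_c) (negPf (nz_z _)) /= => ->.
subst I'.
have eq_w k : (k < #|I|)%N -> zeta ^+ (r * elt I k) * w k = c * w' k.
  by move=> lt_k; rewrite -(coef_spoly w lt_k) eq_ww' ?elt_ltn // coef_spoly.
have def_c : c = zeta ^+ (r * elt I 0) by have := eq_w 0%N I_gt0;
  rewrite w0 w'0 !mulr1.
have def_w' k : (k < #|I|)%N -> w' k = zeta ^+ (r * (elt I k - elt I 0)) * w k.
  move=> lt_k; apply: (mulfI nz_c); rewrite -eq_w // def_c mulrA -exprD -mulnDr.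
  by rewrite subnKC ?elt0_leq.
apply: eq_spoly => -[|k] lt_k; first by rewrite w0.
have I_gt1 : (1 < #|I|)%N by apply: leq_trans lt_k.
have [[u X_u def_u] [u' X_u' def_u']] := (rep_w I_gt1, rep_w' I_gt1).
have eq_u : u' = u.
  apply: (representative_unique I_gt1) => //; apply/mem_Delta; exists r => j.
  by rewrite -def_u -def_u' def_w' // -ltn_predRL.
have lt_k' : (k < kof I)%N by rewrite ltn_predRL.
by rewrite (def_u (Ordinal lt_k')) (def_u' (Ordinal lt_k')) eq_u.
Qed.

End Representatives.

(** * Classification over a fixed extension *)

Section PetitIsomorphicEquivalence.

Variables (F : fieldType) (m : nat).

Lemma petit_isomorphic_sym (K L : fieldExtType F) (s : K -> K) (d : K)
    (s' : L -> L) (a : L) :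
  petit_isomorphic m s d s' a -> petit_isomorphic m s' a s d.
Proof.
case=> G [[H GK HK] G_lin GM]; exists H; split; first by exists G.
- by move=> c g h; rewrite -{1}(HK g) -{1}(HK h) -G_lin GK.
by move=> g h; rewrite -{1}(HK g) -{1}(HK h) -GM GK.
Qed.

Lemma petit_isomorphic_trans (K L M : fieldExtType F) (s : K -> K) (d : K)
    (s' : L -> L) (a : L) (s'' : M -> M) (a' : M) :
  petit_isomorphic m s d s' a -> petit_isomorphic m s' a s'' a' ->
  petit_isomorphic m s d s'' a'.
Proof.
case=> G [G_bij G_lin GM] [G' [G'_bij G'_lin G'M]]; exists (G' \o G).
by split=> [|c g h|g h] /=;
  [exact: bij_comp | rewrite G_lin G'_lin | rewrite GM G'M].
Qed.

End PetitIsomorphicEquivalence.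

Section RadicalCyclic.

Variables (F : finFieldType) (m : nat) (zeta b : F) (L : splittingFieldType F).
Variable beta : L.
Hypotheses (m_prime : prime m) (zeta_prim : m.-primitive_root zeta).
Hypothesis b_npow : forall c : F, c ^+ m <> b.
Hypotheses (dim_L : \dim {:L} = m) (beta_m : beta ^+ m = b%:A).

Let m_gt1 : (1 < m)%N. Proof. exact: prime_gt1. Qed.
Let m_gt0 : (0 < m)%N. Proof. exact: prime_gt0. Qed.

Lemma radical_notin : beta \notin 1%VS.
Proof.
apply/negP=> /vlineP[c def_beta]; apply: (@b_npow c); apply: (@scalar_inj F L).
by rewrite /= -beta_m def_beta -![_%:A]/(in_alg L _) rmorphXn.
Qed.

Lemma radical_neq0 : beta != 0.
Proof. by apply: contraNneq radical_notin => ->; rewrite mem0v. Qed.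

Lemma radical_poly_unique (p q : {poly F}) : (size p <= m)%N ->
  (size q <= m)%N ->
  horner_alg beta p = horner_alg beta q -> p = q.
Proof.
move=> le_p le_q eq_pq; apply/eqP; rewrite -subr_eq0; apply/eqP.
apply: (radical_horner_inj m_prime dim_L radical_notin).
  by rewrite (leq_trans (size_polyD _ _)) // size_polyN geq_max le_p.
by rewrite rmorphB /= eq_pq subrr.
Qed.

(** The quotient [sigma beta / beta] is an [m]-th root of unity; were it 1,
    [beta] would be fixed by the Galois group, hence a scalar. *)
Lemma generator_radical (sigma : gal_of {:L}) : cyclic_generator m sigma ->
  exists2 z : F, m.-primitive_root z & sigma beta = z *: beta.
Proof.
move=> sigma_gen; have [r def_r] := gal_radical_eigen sigma zeta_prim beta_m.
exists (zeta ^+ r) => //; apply: prime_primitive_root => //.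
  by rewrite exprAC (prim_expr_order zeta_prim) expr1n.
apply: contraNneq radical_notin => z1.
have [|c ->] := gal_fixed_scalar sigma_gen (x := beta);
  first by rewrite def_r z1 scale1r.
by apply/vlineP; exists c.
Qed.

Lemma rmorph_radical_horner (rho : {rmorphism L -> L}) (z : F) (p : {poly F}) :
    (forall c : F, rho c%:A = c%:A) -> rho beta = z *: beta ->
  rho (horner_alg beta p) = horner_alg beta (\poly_(i < size p) (z ^+ i *
    p`_i)).
Proof. by move=> rho_alg rho_b;
  rewrite rmorph_horner_alg // rho_b horner_alg_scale. Qed.

Lemma coef_twist (z : F) (p : {poly F}) j :
  (\poly_(i < size p) (z ^+ i * p`_i))`_j = z ^+ j * p`_j.
Proof.
by rewrite coef_poly; case: ltnP => // le_pj; rewrite [p`_j]nth_default ?mulr0.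
Qed.

Lemma gal_eq_radical (sigma sigma' : gal_of {:L}) :
  sigma beta = sigma' beta -> sigma = sigma'.
Proof.
move=> eq_b; apply/eqP/gal_eqP => x _.
have [p /andP[_ /eqP <-]] := radical_horner_surj m_prime dim_L radical_notin x.
by rewrite !rmorph_horner_alg /= ?eq_b // => c; apply: gal_scalar.
Qed.

Variable X : forall I : {set 'I_m}, {set {dffun forall _ : 'I_(kof I), {unit
  F}}}.

(** Some [i <> 0] occurs in the support [I], and [sigma] multiplies [beta^i] by
    a nontrivial root of unity. *)
Lemma SL_nonfixed (sigma : gal_of {:L}) a :
  cyclic_generator m sigma -> SL beta X a -> sigma a != a.
Proof.
move=> sigma_gen /SL_spoly[I [w [nz_I ne_I [_ nz_w _] ->]]].
have [z z_prim def_z] := generator_radical sigma_gen.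
have [i I_i nz_i] : exists2 i : 'I_m, i \in I & val i != 0%N.
  apply/exists_inP; apply: contraNT ne_I => no_i.
  have I0 j : j \in I -> val j = 0%N.
    by move=> I_j; apply/eqP; apply: contraNT no_i => nz_j; apply/exists_inP;
      exists j.
  have [I0'|[i0 I_i0]] := set_0Vmem I; first by rewrite I0' eqxx in nz_I.
  apply/eqP/setP=> i; rewrite inE; apply/idP/eqP => [/I0 // | i_0].
  by rewrite (_ : i = i0) //; apply: val_inj; rewrite i_0 I0.
apply/eqP; rewrite (rmorph_radical_horner _ (@gal_scalar _ _ sigma) def_z).
move/radical_poly_unique => eq_p.
have le_p := size_spoly I w.
have := congr1 (fun p : {poly F} =>
  p`_i) (eq_p (leq_trans (size_poly _ _) le_p) le_p).
rewrite coef_twist; have [j lt_j def_i] := mem_elt I_i;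
  rewrite -def_i coef_spoly //.
rewrite -[RHS]mul1r => /(mulIf (nz_w j lt_j))/eqP; rewrite def_i.
rewrite -(prim_order_dvd z_prim) => /dvdn_leq; rewrite lt0n => /(_ nz_i).
by rewrite leqNgt ltn_ord.
Qed.

Hypothesis X_reps : coset_representatives zeta X.

(** An isomorphism [G] acts on [L] as some automorphism [rho], and sends each
    [t^j] to a multiple of the power [t^i] such that [z'^i = z^j], for the
    eigenvalues [z] of [sigma] and [z'] of [sigma'] at [beta].  By
    [iso_top_degree], [i = m - 1] only for [j = m - 1], which forces [z' = z].
    Then [G t = k t], so that [rho a] is the norm of [k] times [a'], and
    [rep_weight_unique] applies. *)
Lemma SL_rigid (sigma sigma' : gal_of {:L}) a a' :
    cyclic_generator m sigma -> cyclic_generator m sigma' ->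
    SL beta X a -> SL beta X a' -> petit_isomorphic m sigma a sigma' a' ->
  sigma = sigma' /\ a = a'.
Proof.
move=> gen gen' Sa Sa' [G [G_bij G_lin GM]].
have nfix' := SL_nonfixed gen' Sa'.
have [rho [G_const rho_alg]] := iso_restricts_to_constants m_gt1 nfix' G_bij
  G_lin GM.
have [l rho_beta] : exists l, rho beta = zeta ^+ l *: beta.
  have [|l def_l] := scalar_root_of_unity zeta_prim (x := rho beta / beta).
    by rewrite expr_div_n -rmorphXn beta_m rho_alg divff // -beta_m expf_neq0
      ?radical_neq0.
  by exists l; rewrite -mulr_algl -def_l divfK ?radical_neq0.
have [z z_prim def_z] := generator_radical gen.
have [z' z'_prim def_z'] := generator_radical gen'.
have galZ (s : gal_of {:L}) (c : F) x : s (c *: x) = c *: s x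
  by rewrite linearZ.
have iter_b (s : gal_of {:L}) y n : s beta = y *: beta ->
  iter n s beta = y ^+ n *: beta.
  move=> def_y; elim: n => [|n IHn]; first by rewrite scale1r.
  by rewrite iterS IHn galZ def_y scalerA exprSr.
have rhoZ (c : F) x : rho (c *: x) = c *: rho x.
  by rewrite -mulr_algl rmorphM rho_alg mulr_algl.
have iterZ (s : gal_of {:L}) n (c : F) x : iter n s (c *: x) = c *: iter n s x.
  by elim: n => //= n ->; rewrite galZ.
have eigen j i : (j < m)%N -> (G (mono m 1 j))`_i != 0 -> z' ^+ i = z ^+ j.
  move=> lt_j nz_g; have := iso_twisted_commutation m_gt1 GM G_const beta i
    lt_j.
  rewrite mulrC => /(mulIf nz_g).
  rewrite (iter_b _ _ _ def_z) rhoZ rho_beta iterZ (iter_b _ _ _ def_z').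
  rewrite !scalerA mulrC => /eqP.
  rewrite -subr_eq0 -scalerBl scaler_eq0 (negPf radical_neq0) orbF subr_eq0.
  by rewrite (inj_eq (mulIf _)) ?expf_neq0 ?(primitive_root_neq0 zeta_prim) //
    => /eqP.
have G_mono j i : (j < m)%N -> (i < m)%N -> z' ^+ i = z ^+ j ->
    exists2 k, k != 0 & G (mono m 1 j) = mono m k i.
  move=> lt_j lt_i eq_ij.
  have def_G : G (mono m 1 j) = mono m (G (mono m 1 j))`_i i.
    apply/npolyP => i'; rewrite coef_mono //; case: eqP => [-> // | ne_ii'].
    have [lt_i' | le_i'] := ltnP i' m; last by rewrite big_coef_npoly.
    apply/eqP; apply: contra_notT ne_ii' => /(eigen _ _ lt_j)/eqP.
    by rewrite -eq_ij (eq_prim_root_expr z'_prim) !modn_small // => /eqP.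
  exists (G (mono m 1 j))`_i => //; have := iso_mono_neq0 G_bij G_lin lt_j.
  by apply: contraNneq => G0; rewrite def_G G0 mono0.
have z_neq1 : z != 1.
  apply: contraTneq m_gt1 => z1; rewrite -leqNgt dvdn_leq //.
  by rewrite (prim_order_dvd z_prim) z1 expr1n.
have eq_z : z' = z.
  have [|[j lt_j] /= def_j] := prim_rootP z_prim (x := z' ^+ m.-1).
    by rewrite exprAC (prim_expr_order z'_prim) expr1n.
  have [|[l1 lt_l] /= def_l] := prim_rootP z_prim (x := z' ^+ 1).
    by rewrite (prim_expr_order z'_prim).
  have [|[i lt_i] /= def_i] := prim_rootP z'_prim (x := z ^+ 1).
    by rewrite (prim_expr_order z_prim).
  have i_gt0 : (0 < i)%N.
    by case: (i) def_i => // z1; rewrite expr1 expr0 in z1;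
      rewrite z1 eqxx in z_neq1.
  have lt_m1 : (m.-1 < m)%N by rewrite prednK.
  have [k1 nz1 G1] := G_mono 1%N i m_gt1 lt_i (esym def_i).
  have [k2 nz2 Gj] := G_mono j m.-1 lt_j lt_m1 def_j.
  have [k3 nz3 Gl] := G_mono l1 1%N lt_l m_gt1 def_l.
  have [lt_j1 | le_j1] := ltnP j.+1 m.
    by case: (iso_top_degree m_gt1 nfix' GM (i := i) (j := j) (l := l1) _
      lt_j1 lt_l
      nz1 nz2 nz3 _ G1 Gj Gl); rewrite ?i_gt0 ?gal_iter_period.
  have def_m : j.+1 = m by apply/eqP; rewrite eqn_leq lt_j.
  have nz_z1 : z ^+ j != 0.
    by rewrite expf_neq0 ?(primitive_root_neq0 z_prim).
  apply: (mulIf nz_z1); rewrite -exprS -{1}def_j -def_m /= -exprS def_m.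
  by rewrite (prim_expr_order z_prim) (prim_expr_order z'_prim).
have eq_sigma : sigma = sigma' by apply: gal_eq_radical;
  rewrite def_z def_z' eq_z.
split=> //; subst sigma'.
have [k nz_k G1] := G_mono 1%N 1%N m_gt1 m_gt1 (congr1 _ eq_z).
have rho_a := iso_tnorm m_gt1 GM G_const G1.
have [c def_c] : exists c : F, tnorm sigma k m = c%:A.
  apply: (gal_fixed_scalar gen); apply: (mulfI nz_k).
  by rewrite -tnormS -addn1 tnormD gal_iter_period // tnormS tnorm0 rmorph1
    mulr1 mulrC.
have nz_c : c != 0.
  apply/eqP=> c0; have := tnorm_eq0 sigma k m.
  by rewrite def_c c0 scale0r eqxx (negPf nz_k).
move: rho_a; rewrite def_c mulr_algl.
have /SL_spoly[I [w [nz_I _ rep_w ->]]] := Sa.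
have /SL_spoly[I' [w' [_ _ rep_w' ->]]] := Sa'.
rewrite (rmorph_radical_horner _ rho_alg rho_beta) => eq_aa'.
congr (horner_alg _ _).
apply: (rep_weight_unique m_gt0 zeta_prim X_reps _ nz_c rep_w rep_w' (r := l)).
  by rewrite card_gt0.
move=> j _; rewrite exprM -coef_twist -coefZ.
congr ((_ : {poly F})`_j).
apply: radical_poly_unique.
- exact: leq_trans (size_poly _ _) (size_spoly _ _).
- exact: leq_trans (size_scale_leq _ _) (size_spoly _ _).
by rewrite eq_aa' -mul_polyC rmorphM /= horner_algC mulr_algl.
Qed.

End RadicalCyclic.

(** * Every proper algebra has exactly one representative *)

Theorem theorem5p1 (F : finFieldType) (m : nat) (zeta : F)
    (L : splittingFieldType F) (sigma0 : gal_of {:L}) (b : F) (beta : L)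
    (X : forall I : {set 'I_m}, {set {dffun forall _ : 'I_(kof I), {unit F}}})
    (m_prime : prime m) (m_odd : odd m)
    (F_char_odd : 2%N \notin [pchar F])
    (zeta_prim : m.-primitive_root zeta)
    (sigma0_gen : cyclic_generator m sigma0)
    (b_neq0 : b != 0) (b_npow : forall c : F, c ^+ m <> b)
    (L_split : splittingFieldFor 1%VS ('X^m - b%:A%:P) {:L})
    (beta_root : root ('X^m - b%:A%:P) beta)
    (sigma0_beta : sigma0 beta = zeta *: beta)
    (X_reps : coset_representatives zeta X) :
  (forall (sigma : gal_of {:L}) (a : L),
     cyclic_generator m sigma -> SL beta X a -> proper_petit m sigma a)
  /\
  (forall (K : splittingFieldType F) (tau : gal_of {:K}) (d : K),
     cyclic_generator m tau -> proper_petit m tau d ->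
     exists! p : gal_of {:L} * L,
       [/\ cyclic_generator m p.1, SL beta X p.2
         & petit_isomorphic m tau d p.1 p.2]).
Proof.
have [m_gt0 m_gt1] := (prime_gt0 m_prime, prime_gt1 m_prime).
have beta_m : beta ^+ m = b%:A.
  by move: beta_root; rewrite rootE !hornerE subr_eq0 => /eqP.
have [dim_L gal_L gen_L] := sigma0_gen.
split=> [sigma a gen Sa | K tau d gen proper].
  apply: petit_nonassociative => //.
  exact: (SL_nonfixed m_prime zeta_prim b_npow dim_L beta_m gen Sa).
have [dim_K _ _] := gen.
have tau_d : tau d != d.
  apply/eqP=> tau_d; apply: proper; apply: petit_associative_fixed => //.
  exact: gal_iter_period.
(* Both K and L are generated by an m-th root of b, and p represents d. *)
have [beta' [s [beta'_m tau_beta' z_neq1]]] :=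
  radical_generator gen m_prime zeta_prim b_neq0 b_npow.
have notin' := radical_notin b_npow beta'_m.
have [p /andP[le_p /eqP def_d]] := radical_horner_surj m_prime dim_K notin' d.
have [i nz_i] : exists i : 'I_m, p`_i != 0.
  apply/existsP; apply: contraR tau_d; rewrite negb_exists => /forallP p0.
  rewrite -def_d (_ : p = 0) ?rmorph0 //; apply/polyP => j; rewrite coef0.
  have [lt_j | le_j] := ltnP j m;
    last by rewrite nth_default // (leq_trans le_p).
  by have := p0 (Ordinal lt_j); rewrite negbK => /eqP.
have [r [c [w [nz_c rep_w def_w]]]] := rep_weight_exists m_gt0 zeta_prim
  X_reps le_p nz_i.
set I := [set j : 'I_m | p`_j != 0] in rep_w def_w.
pose a := horner_alg beta (spoly I w).
have Sa : SL beta X a.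
  apply/SL_spoly; exists I, w; split=> //.
    by apply/set0Pn; exists i; rewrite inE.
  apply: contraNneq tau_d => def_I.
  have -> : d = (p`_0)%:A; last by rewrite gal_scalar.
  rewrite -def_d -(horner_algC beta'); congr (horner_alg _ _).
  apply/polyP => j; rewrite coefC; case: eqP => [-> // | /eqP nz_j].
  have [lt_j | le_j] := ltnP j m;
    last by rewrite nth_default // (leq_trans le_p).
  have : Ordinal lt_j \notin I by rewrite def_I inE.
  by rewrite inE negbK => /eqP.
(* Composing the identification of K with L with the automorphism that
   multiplies beta by zeta^r makes the image of d a multiple of a. *)
pose beta1 := zeta ^+ r *: beta.
have beta1_m : beta1 ^+ m = b%:A.
  by rewrite exprZn exprAC (prim_expr_order zeta_prim) expr1n scale1r.
have [phi [phi_bij phiE]] := radical_transfer m_prime dim_K dim_L beta'_m notin'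
  beta1_m (radical_notin b_npow beta1_m).
(* The automorphism of L that corresponds to tau is the power of sigma0 with the
   same eigenvalue. *)
pose sigma := (sigma0 ^+ s)%g.
have sigma_beta : sigma beta = zeta ^+ s *: beta.
  rewrite /sigma gal_expgE; elim: s {tau_beta' z_neq1 sigma} => [|n IHn].
    by rewrite scale1r.
  by rewrite iterS IHn linearZ /= sigma0_beta scalerA exprSr.
have sigma_gen : cyclic_generator m sigma.
  split=> //; rewrite (eqP gen_L) generator_coprime (gal_generator_orderE
    sigma0_gen).
  by rewrite prime_coprime // (prim_order_dvd zeta_prim).
have phi_alg (e : F) : phi e%:A = e%:A.
  by rewrite -(horner_algC beta') phiE horner_algC.
have phi_tau x : phi (tau x) = sigma (phi x).
  have [q /andP[_ /eqP <-]] := radical_horner_surj m_prime dim_K notin' x.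
  rewrite [tau _](rmorph_horner_alg (phi := tau) _ _ (gal_scalar tau)) /=
    tau_beta'.
  rewrite horner_alg_scale !phiE.
  rewrite [RHS](rmorph_horner_alg (phi := sigma) _ _ (gal_scalar sigma)) /=.
  have -> : sigma beta1 = zeta ^+ s *: beta1.
    by rewrite linearZ /= sigma_beta !scalerA mulrC.
  by rewrite [RHS]horner_alg_scale.
have phi_d : phi d = c%:A * a.
  rewrite -def_d phiE horner_alg_scale mulr_algl /a.
  have -> : c *: horner_alg beta (spoly I w) = horner_alg beta (c *: spoly I w).
    by rewrite -mul_polyC rmorphM /= horner_algC mulr_algl.
  congr (horner_alg _ _); apply/polyP => j.
  by rewrite coef_twist coefZ -exprM def_w.
have [k nz_k def_k] := tnorm_surjective m_prime m_odd (prim_expr_order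
  zeta_prim)
  b_neq0 b_npow beta_m sigma_beta (gal_scalar sigma) nz_c.
have iso_a : petit_isomorphic m tau d sigma a.
  apply: (petit_isomorphic_twist m_gt0 phi_bij phi_tau phi_alg nz_k).
  by rewrite phi_d def_k.
exists (sigma, a); split=> //= -[sigma' a'] /= [gen' Sa' iso_a'].
have [-> ->] := SL_rigid m_prime zeta_prim b_npow dim_L beta_m X_reps
  sigma_gen gen'
  Sa Sa' (petit_isomorphic_trans (petit_isomorphic_sym iso_a) iso_a') => //.
Qed.
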